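(* Consider a real planar billiard in $\mathbb{R}^2$ with piecewise-algebraic boundary. Suppose that the complexifications in $\mathbb{CP}^2$ of the algebraic pieces of the boundary contain neither of the isotropic points at infinity $I_1=(1:i:0)$, $I_2=(1:-i:0)$. Then the set of odd-periodic orbits of the billiard has measure zero.
   Context: $\mathbb{R}^2$ carries the Euclidean metric, and $\mathbb{R}^2\subset\mathbb{C}^2\subset\mathbb{CP}^2$ in the standard way. The boundary is piecewise-algebraic if it consists of finitely many arcs (''pieces'') of real planar algebraic curves; the complexification of a piece is the complex projective algebraic curve in $\mathbb{CP}^2$ containing it (the Zariski closure of the piece). In the billiard, a point moves along straight segments inside the domain and at each boundary point that it meets it reflects according to the usual law (angle of incidence equals angle of reflection with respect to the tangent line of the boundary); the reflection takes place at the first point where the ray meets the boundary. An orbit is $k$-periodic if it is closed with $k$ reflections (vertices $A_1,\dots,A_k$ on the boundary, successive edges related by the reflection law, indices cyclic), and odd-periodic if it is $k$-periodic for some odd $k$. ''Measure zero'' refers to the natural (Lebesgue) measure on the phase space of the billiard, i.e. on the two-dimensional space of pairs (boundary point, unit vector directed inside the domain), where a periodic orbit is represented by its initial data. *)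

(* Defs.v *)
From HB Require Import structures.
From mathcomp Require Import all_boot all_order all_algebra.
From mathcomp Require Import all_classical all_reals all_analysis.
From mathcomp Require Import complex.
(* The notations of mpoly clash with those of the analysis library. *)
From mathcomp Require Import -(notations) mpoly.

Set Implicit Arguments.
Unset Strict Implicit.
Unset Printing Implicit Defensive.

Import Order.TTheory GRing.Theory Num.Theory.
Import numFieldNormedType.Exports.

Local Open Scope classical_set_scope.
Local Open Scope ring_scope.

Definition dotp (R : realType) (u v : R * R) : R := u.1 * v.1 + u.2 * v.2.

Definition unit_vector (R : realType) (v : R * R) : Prop := dotp v v = 1.

Definition direction (R : realType) (theta : R) : R * R := (cos theta, sin theta).

(* The parameter interval may be open, half-open, closed or unbounded.
   Injectivity and regularity cost no generality for arcs of algebraic curves,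
   which are finite unions of such arcs; nothing is required of the derivative
   at the endpoints, so an arc may end at a cusp of its curve. *)
Record regular_arc (R : realType) := RegularArc {
  arc_dom : interval R;
  arc_fun :> R -> R * R;
  arc_dom_nondegenerate : [set` arc_dom]° !=set0;
  arc_continuous : {within [set` arc_dom], continuous arc_fun};
  arc_injective : {in arc_dom &, injective arc_fun};
  arc_derivable : forall t : R, [set` arc_dom]° t -> derivable arc_fun t 1;
  arc_derive_continuous :
    forall t : R, [set` arc_dom]° t -> {for t, continuous (derive1 arc_fun)};
  arc_regular : forall t : R, [set` arc_dom]° t -> derive1 arc_fun t != 0
}.

Definition arc_image (R : realType) (g : regular_arc R) : set (R * R) :=
  g @` [set` arc_dom g].

Definition algebraic_arc (R : realType) (g : regular_arc R) : Prop :=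
  exists2 P : mpoly.mpoly 2 R, P != 0 &
    forall p, arc_image g p ->
      mpoly.meval (fun i : 'I_2 => [:: p.1; p.2]`_i) P = 0.

Definition boundary (T : topologicalType) (A : set T) : set T :=
  closure A `\` A°.

Definition domain (R : realType) (Omega : set (R * R)) : Prop :=
  [/\ open Omega, connected Omega & Omega !=set0].

Definition piecewise_algebraic_boundary (R : realType) (Omega : set (R * R))
    (n : nat) (piece : 'I_n -> regular_arc R) : Prop :=
  (forall j, algebraic_arc (piece j)) /\
  boundary Omega = \bigcup_(j in [set: 'I_n]) arc_image (piece j).

(* CP^2, through homogeneous coordinates: the point (z_0 : z_1 : z_2) is
   represented by all its nonzero coordinate vectors, and a subset of CP^2 by
   the set of all coordinate vectors of its points.  The affine chart is
   (x, y) |-> (x : y : 1), so z_2 = 0 is the line at infinity. *)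
Definition hcoord (R : realType) (a b c : R[i]) : 'rV[R[i]]_3 :=
  \row_(i < 3) [:: a; b; c]`_i.

Definition real_point (R : realType) (p : R * R) : 'rV[R[i]]_3 :=
  hcoord (p.1)%:C%C (p.2)%:C%C 1.

Definition heval (R : realType) (F : mpoly.mpoly 3 R[i]) (z : 'rV[R[i]]_3) :
  R[i] := mpoly.meval (fun i => z 0 i) F.

Definition zariski_closure (R : realType) (S : set (R * R)) :
    set 'rV[R[i]]_3 :=
  [set z | z != 0 /\
    forall (d : nat) (F : mpoly.mpoly 3 R[i]),
      F \is mpoly.ishomog1 d mpoly.mdeg ->
      (forall p, S p -> heval F (real_point p) = 0) -> heval F z = 0].

Definition complexification (R : realType) (g : regular_arc R) : set 'rV[R[i]]_3 :=
  zariski_closure (arc_image g).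

Definition isotropic_point1 (R : realType) : 'rV[R[i]]_3 := hcoord 1 'i%C 0.
Definition isotropic_point2 (R : realType) : 'rV[R[i]]_3 := hcoord 1 (- 'i%C) 0.

(* u is a unit vector on the tangent line at p to the set B, which near p has
   to coincide with a regular arc passing through p; in particular there is no
   tangent line at a corner.  Compactness of the parameter interval excludes
   arcs that accumulate on themselves. *)
Definition unit_tangent (R : realType) (B : set (R * R)) (p u : R * R) : Prop :=
  unit_vector u /\
  exists (g : regular_arc R) (t c : R),
    [/\ compact [set` arc_dom g], [set` arc_dom g]° t, g t = p,
        \forall q \near p, B q <-> arc_image g q & derive1 g t = c *: u].

Definition reflect_dir (R : realType) (u v : R * R) : R * R :=
  (2 * dotp v u) *: u - v.

(* A state (A, v) is a boundary point with a unit vector directed inside. *)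
Definition phase_space (R : realType) (Omega : set (R * R)) :
    set ((R * R) * (R * R)) :=
  [set x | [/\ boundary Omega x.1, unit_vector x.2 &
    exists2 e : R, 0 < e & forall s, 0 < s < e -> Omega (x.1 + s *: x.2)]].

(* From x = (A, v) the point runs inside Omega until it first meets the
   boundary, at y.1, and leaves y.1 in the reflected direction y.2. *)
Definition billiard_step (R : realType) (Omega : set (R * R))
    (x y : (R * R) * (R * R)) : Prop :=
  exists t : R,
    [/\ 0 < t, (forall s, 0 < s < t -> Omega (x.1 + s *: x.2)),
        y.1 = x.1 + t *: x.2, boundary Omega y.1 &
        exists2 u, unit_tangent (boundary Omega) y.1 u &
                   y.2 = reflect_dir u x.2].

Definition periodic_orbit (R : realType) (Omega : set (R * R)) (k : nat)
    (x : nat -> (R * R) * (R * R)) : Prop :=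
  [/\ forall j, (j < k)%N -> phase_space Omega (x j),
      forall j, (j < k)%N -> billiard_step Omega (x j) (x j.+1) &
      x k = x 0%N].

Definition odd_periodic (R : realType) (Omega : set (R * R)) :
    set ((R * R) * (R * R)) :=
  [set x0 | exists k x, [/\ odd k, periodic_orbit Omega k x & x 0%N = x0]].

(* Lebesgue measure zero in the phase space, in the charts
   (t, theta) |-> (g t, (cos theta, sin theta)) given by the pieces g of the
   boundary: there the measure ds dtheta (s the arc length) has the positive
   density |g'(t)| with respect to dt dtheta, and the endpoints of the pieces
   contribute nothing. *)
Definition phase_measure_zero (R : realType) (n : nat) (piece : 'I_n -> regular_arc R)
    (S : set ((R * R) * (R * R))) : Prop :=
  forall j : 'I_n,
    ((@lebesgue_measure R) \x (@lebesgue_measure R))%E.-negligible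
      [set x : R * R | [/\ [set` arc_dom (piece j)]° x.1, 0 <= x.2 < 2 * pi &
                           S (piece j x.1, direction x.2)]].

(* Main.v *)
Require Import Defs.
From mathcomp Require Import all_boot all_order all_algebra.
From mathcomp Require Import all_classical all_reals all_analysis.
From mathcomp Require Import measurable_realfun polyXY separable closed_field.
From mathcomp Require Import complex.
From mathcomp Require Import -(notations) mpoly.
From mathcomp Require Import ring lra zify.

Set Implicit Arguments.
Unset Strict Implicit.
Unset Printing Implicit Defensive.

Import Order.TTheory GRing.Theory Num.Theory.
Import numFieldNormedType.Exports.

Local Open Scope classical_set_scope.
Local Open Scope ring_scope.

(** Why odd periodic orbits are negligible.

    In the isotropic coordinates z = x + iy, w = x - iy a direction is a pair
    (l, l') with l l' = 1, and everything that a billiard orbit satisfies is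
    polynomial: an edge from (z, w) to (z', w') means l' (z' - z) = l (w' - w),
    and a reflection in the tangent direction (n, n') sends (l, l') to
    (n^2 l', n'^2 l).  So every periodic orbit is a point of a complex
    algebraic set of closed complex orbits, in which l may take any nonzero
    complex value.

    Suppose that l is close to 0, and that the orbit starts at a point whose
    coordinate z is close to a generic value z0.  The first edge is then nearly
    the isotropic line z = z0.  This line meets the line at infinity only in an
    isotropic point, and the boundary avoids this point; hence the next vertex
    stays in a bounded region and is close to one of the finitely many points
    (z0, w0) of the boundary curve.  As z0 is generic, the curve is smooth
    there and its tangent is not the line z = z0, so that n'^2 is bounded and
    the new l' = n'^2 l is small.  Now the same argument applies with z and w
    exchanged, starting from the generic value w0.  Thus the small component
    alternates between l and l', and after an odd number of reflections l' is
    small, whereas l was small at the start: since l l' = 1, the orbit cannot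
    close up ([no_small_odd_cycle]).

    It remains to pass from small l to all l.  By quantifier elimination over
    the algebraically closed field of complex numbers, the starting data of
    closed complex orbits of length k are described by a quantifier-free
    formula ([cycle_quantifier_elim]).  For fixed z and w such a formula in l
    is constant outside a finite set; for odd k and generic z the constant is
    false because small l are excluded, so only finitely many directions remain
    ([cycle_direction_root]).  The formula also defines a measurable set of
    parameters (t, theta), and Fubini concludes ([arc_chart_null]): the
    exceptional z are finite in number and the pieces are injective, so all but
    finitely many sections are finite.  The real tangent lines satisfy the
    algebraic tangency relation by [vertex_tangent], and the bound that keeps
    the vertices away from infinity is [isotropic_growth]. *)

(** * Polynomial estimates for the complex modulus *)

(** The modulus is kept real-valued, whereas the norm of [R[i]] takes its
    values in the partially ordered field [R[i]]. *)
Definition modulus (R : rcfType) (x : R[i]) : R := ComplexField.Normc.normc x.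

Section Modulus.
Variable R : rcfType.
Implicit Types x y : R[i].
Local Notation N := (@modulus R).

Lemma modulusM x y : N (x * y) = N x * N y.
Proof. exact: ComplexField.Normc.normcM. Qed.

Lemma modulusD x y : N (x + y) <= N x + N y.
Proof. exact: le_normcD. Qed.

Lemma modulusN x : N (- x) = N x.
Proof. exact: normcN. Qed.

Lemma modulus0 : N 0 = 0.
Proof. exact: ComplexField.Normc.normc0. Qed.

Lemma modulus1 : N 1 = 1.
Proof. exact: ComplexField.Normc.normc1. Qed.

Lemma modulus_ge0 x : 0 <= N x.
Proof. by case: x => a b; exact: sqrtr_ge0. Qed.

Lemma modulus_eq0 x : (N x == 0) = (x == 0).
Proof.
apply/eqP/eqP => [|->]; first exact: ComplexField.Normc.eq0_normc.
exact: modulus0.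
Qed.

Lemma modulus_gt0 x : (0 < N x) = (x != 0).
Proof. by rewrite lt_def modulus_ge0 andbT modulus_eq0. Qed.

Lemma modulusB x y : N (x - y) <= N x + N y.
Proof. by rewrite -(modulusN y) modulusD. Qed.

Lemma modulus_sub_le x y : N x <= N (x - y) + N y.
Proof. by have := modulusD (x - y) y; rewrite subrK. Qed.

Lemma modulusBC x y : N (x - y) = N (y - x).
Proof. by rewrite -modulusN opprB. Qed.

Lemma modulusV x : N x^-1 = (N x)^-1.
Proof. exact: ComplexField.Normc.normcV. Qed.

Lemma modulusX x n : N (x ^+ n) = N x ^+ n.
Proof.
by elim: n => [|n IH]; rewrite ?expr0 ?modulus1 // !exprS modulusM IH.
Qed.

Lemma modulus_real (a : R) : N a%:C%C = `|a|.
Proof. by rewrite /modulus /= expr0n /= addr0 sqrtr_sqr. Qed.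

Lemma poly_lipschitz (p : {poly R[i]}) (M : R) :
  exists2 K : R, 0 <= K & forall x x', N x <= M -> N x' <= M ->
    N (p.[x] - p.[x']) <= K * N (x - x').
Proof.
elim/poly_ind: p => [|p c [K K0 HK]].
  by exists 0 => // x x' _ _; rewrite !horner0 subr0 modulus0 mul0r.
have [M0|M0] := leP 0 M; last first.
  by exists 0 => // x x' xM; have := modulus_ge0 x; lra.
pose B := N p.[0] + K * M.
exists (K * M + B) => [|x x' xM x'M].
  by have := modulus_ge0 p.[0]; have := mulr_ge0 K0 M0; rewrite /B; lra.
have h1 := HK _ _ xM x'M.
have h2 : N p.[x'] <= B.
  have h := HK x' 0 x'M; rewrite modulus0 subr0 in h.
  have := modulus_sub_le p.[x'] p.[0]; have := h M0.
  have := ler_wpM2l K0 x'M; rewrite /B; lra.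
rewrite !hornerMXaddC.
have -> : p.[x] * x + c - (p.[x'] * x' + c) =
    (p.[x] - p.[x']) * x + p.[x'] * (x - x') by ring.
apply: (le_trans (modulusD _ _)); rewrite !modulusM.
have e1 := ler_pM (modulus_ge0 _) (modulus_ge0 _) h1 xM.
have e2 := ler_wpM2r (modulus_ge0 (x - x')) h2.
have -> : (K * M + B) * N (x - x') = K * N (x - x') * M + B * N (x - x').
  by ring.
lra.
Qed.

Lemma poly2_lipschitz (p : {poly {poly R[i]}}) (M : R) :
  exists2 K : R, 0 <= K & forall x y x' y',
    N x <= M -> N y <= M -> N x' <= M -> N y' <= M ->
    N (p.[x, y] - p.[x', y']) <= K * (N (x - x') + N (y - y')).
Proof.
elim/poly_ind: p => [|p c [K K0 HK]].
  by exists 0 => // x y x' y' _ _ _ _; rewrite !(horner0, subr0) modulus0 mul0r.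
have [M0|M0] := leP 0 M; last first.
  by exists 0 => // x y x' y' xM; have := modulus_ge0 x; lra.
have [L L0 HL] := poly_lipschitz c M.
pose B := N p.[0, 0] + K * (M + M).
have B0 : 0 <= B.
  by rewrite /B; have := modulus_ge0 p.[0, 0]; have := mulr_ge0 K0 M0; lra.
exists (K * M + B + L) => [|x y x' y' xM yM x'M y'M].
  by have := mulr_ge0 K0 M0; lra.
rewrite !hornerMXaddC !hornerD !hornerM !hornerC.
have -> : p.[x, y] * x + c.[y] - (p.[x', y'] * x' + c.[y']) =
  (p.[x, y] - p.[x', y']) * x + p.[x', y'] * (x - x') + (c.[y] - c.[y']) by ring.
apply: (le_trans (modulusD _ _)); apply: (le_trans (lerD (modulusD _ _) (lexx _))).
rewrite !modulusM.
have h1 := HK _ _ _ _ xM yM x'M y'M.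
have h2 : N p.[x', y'] <= B.
  have h := HK x' y' 0 0 x'M y'M; rewrite modulus0 !subr0 in h.
  have := modulus_sub_le p.[x', y'] p.[0, 0]; have := h M0 M0.
  have := ler_wpM2l K0 (lerD x'M y'M); rewrite /B polyC0; lra.
have e1 := ler_pM (modulus_ge0 _) (modulus_ge0 _) h1 xM.
have e2 := ler_wpM2r (modulus_ge0 (x - x')) h2.
have e3 := HL _ _ yM y'M.
set a := N (x - x') in e1 e2 *; set b := N (y - y') in e1 e3 *.
have : 0 <= B * b by rewrite mulr_ge0 // modulus_ge0.
have : 0 <= L * a by rewrite mulr_ge0 // modulus_ge0.
have -> : (K * M + B + L) * (a + b) =
  K * (a + b) * M + B * a + B * b + L * a + L * b by ring.
lra.
Qed.

Lemma poly2_bounded (p : {poly {poly R[i]}}) (M : R) :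
  exists2 B : R, 0 <= B & forall x y, N x <= M -> N y <= M -> N p.[x, y] <= B.
Proof.
have [M0|M0] := leP 0 M; last first.
  by exists 0 => // x y xM; have := modulus_ge0 x; lra.
have [K K0 HK] := poly2_lipschitz p M.
exists (N p.[0, 0] + K * (M + M)) => [|x y xM yM].
  by have := modulus_ge0 p.[0, 0]; have := mulr_ge0 K0 M0; lra.
have h := HK x y 0 0 xM yM; rewrite modulus0 !subr0 polyC0 in h.
have := modulus_sub_le p.[x, y] p.[0, 0]; have := h M0 M0.
have := ler_wpM2l K0 (lerD xM yM); rewrite polyC0; lra.
Qed.

(** The factor 1/2 gives a lower bound that is uniform near (a, b): it is what
    bounds a quotient with denominator [p]. *)
Lemma poly2_nonzero_near (p : {poly {poly R[i]}}) (a b : R[i]) :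
  p.[a, b] != 0 ->
  exists2 d : R, 0 < d & forall x y, N (x - a) < d -> N (y - b) < d ->
    p.[x, y] != 0 /\ N p.[a, b] / 2 <= N p.[x, y].
Proof.
move=> pn0; have e0 : 0 < N p.[a, b] by rewrite modulus_gt0.
set e := N p.[a, b] in e0 *.
have [K K0 HK] := poly2_lipschitz p (N a + N b + 1).
have Na := modulus_ge0 a; have Nb := modulus_ge0 b.
have q0 : 0 < e / (4 * (K + 1) + e) by rewrite divr_gt0 //; lra.
exists (e / (4 * (K + 1) + e)) => // x y xa yb.
have d1 : e / (4 * (K + 1) + e) <= 1 by rewrite ler_pdivrMr; lra.
have h : N (p.[x, y] - p.[a, b]) <= K * (N (x - a) + N (y - b)).
  by apply: HK; try lra; [have := modulus_sub_le x a|have := modulus_sub_le y b]; lra.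
have h2 : K * (N (x - a) + N (y - b)) <= e / 2.
  apply: (@le_trans _ _ (K * (2 * (e / (4 * (K + 1) + e))))).
    by apply: ler_wpM2l => //; lra.
  have -> : K * (2 * (e / (4 * (K + 1) + e))) = (2 * K * e) / (4 * (K + 1) + e).
    by ring.
  rewrite ler_pdivrMr; last lra.
  have := mulr_ge0 (ltW e0) (ltW e0); nra.
have h3 := modulus_sub_le p.[a, b] p.[x, y].
rewrite modulusBC in h3; rewrite -modulus_gt0 -/e in h3 *.
by split; lra.
Qed.

Lemma poly2_closed (p : {poly {poly R[i]}}) (a b : R[i]) :
  p.[a, b] != 0 ->
  exists2 d : R, 0 < d & forall x y, N (x - a) < d -> N (y - b) < d ->
    p.[x, y] != 0.
Proof.
by move=> /poly2_nonzero_near[d d0 H]; exists d => // x y /H h /h [].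
Qed.

(** If all the roots are at distance at least e from x, then each factor of the
    splitting of [p] has modulus at least e at x. *)
Lemma root_near_small_value (p : {poly R[i]}) (e : R) : p != 0 -> 0 < e ->
  exists2 d : R, 0 < d & forall x, N p.[x] < d ->
    exists2 a, root p a & N (x - a) < e.
Proof.
move=> p0 e0; have [r pE] := closed_field_poly_normal p.
have l0 : 0 < N (lead_coef p) by rewrite modulus_gt0 lead_coef_eq0.
exists (N (lead_coef p) * e ^+ size r) => [|x].
  by rewrite mulr_gt0 ?exprn_gt0.
rewrite {1}pE hornerZ horner_prod modulusM ltr_pM2l // => hx.
have [/hasP[a ar ha]|] := boolP (has (fun a => N (x - a) < e) r).
  exists a => //; rewrite pE rootZ ?lead_coef_eq0 //.
  by rewrite root_prod_XsubC.
rewrite -all_predC => /allP far; exfalso.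
suff : e ^+ size r <= N (\prod_(z <- r) ('X - z%:P).[x]) by rewrite leNgt hx.
elim: r far {pE hx} => [|a r IH] far; first by rewrite big_nil modulus1.
rewrite big_cons modulusM hornerXsubC exprS; apply: ler_pM.
- exact: ltW.
- exact/exprn_ge0/ltW.
- by have /= := far a (mem_head _ _); rewrite -leNgt.
- by apply: IH => b br; apply: far; rewrite inE br orbT.
Qed.
End Modulus.

(** * Complex orbits near an isotropic direction *)
Section Dynamics.
Variable R : rcfType.
Local Notation C := R[i].
Local Notation N := (@modulus R).

(** The evaluation [p.[x, y]] substitutes x for the outer variable of [p], and
    y for the variable of its coefficients.  For a billiard, both polynomials
    are equations of the boundary (up to finitely many points for the second):
    [growth_poly] controls its points at infinity, and [tangent_poly], which is
    squarefree in the outer variable, its tangent lines. *)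
Record half_curve := HalfCurve {
  growth_poly : {poly {poly C}};
  tangent_poly : {poly {poly C}} }.

(** In [wcurve] the outer variable is w and in [zcurve] it is z, so that the two
    fields exchange their roles together with the two isotropic coordinates.
    Two half-curves are necessary: the first is used on edges that are nearly
    lines z = constant, the second on edges that are nearly w = constant. *)
Record curve := Curve { wcurve : half_curve; zcurve : half_curve }.

Definition swap_curve (Z : curve) := Curve (zcurve Z) (wcurve Z).

Definition on_half (h : half_curve) (x y : C) : Prop :=
  (growth_poly h).[x, y] = 0 /\ (tangent_poly h).[x, y] = 0.

Definition on_curve (Z : curve) (z w : C) : Prop :=
  on_half (wcurve Z) w z /\ on_half (zcurve Z) z w.

Definition tangent_half (h : half_curve) (x y dx dy : C) : Prop :=
  (tangent_poly h)^`().[x, y] * dx +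
  (map_poly (@deriv C) (tangent_poly h)).[x, y] * dy = 0.

(** On the zero set the outer coordinate is controlled by the other one; this
    excludes the point at infinity of the x-axis from the curve. *)
Definition linear_growth (p : {poly {poly C}}) : Prop :=
  exists K : R, forall x y, p.[x, y] = 0 -> N x <= K * (1 + N y).

Definition generically_smooth (p : {poly {poly C}}) (r : {poly C}) : Prop :=
  forall x y, r.[y] != 0 -> p.[x, y] = 0 -> p^`().[x, y] != 0.

(** The position is (pz, pw) and the direction is (dz, dw), both in isotropic
    coordinates; unit vectors satisfy dz * dw = 1. *)
Record state := State { pz : C; pw : C; dz : C; dw : C }.

Definition swap_state (s : state) := State (pw s) (pz s) (dw s) (dz s).

(** The vector (nz, nw) is the unit tangent vector at the new vertex. *)
Definition complex_step (Z : curve) (s t : state) : Prop :=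
  exists nz nw : C,
   [/\ nz * nw = 1, on_curve Z (pz t) (pw t),
       tangent_half (wcurve Z) (pw t) (pz t) nw nz /\
       tangent_half (zcurve Z) (pz t) (pw t) nz nw,
       dw s * (pz t - pz s) = dz s * (pw t - pw s) &
       dz t = nz ^+ 2 * dw s /\ dw t = nw ^+ 2 * dz s].

Fixpoint complex_path (Z : curve) (m : nat) (s t : state) : Prop :=
  if m is m'.+1 then exists2 u, complex_step Z s u & complex_path Z m' u t
  else s = t.

Lemma complex_step_swap Z s t :
  complex_step Z s t -> complex_step (swap_curve Z) (swap_state s) (swap_state t).
Proof.
case=> nz [nw [n1 [c1 c2] [t1 t2] e [d1 d2]]].
by exists nw, nz; split => //; rewrite mulrC.
Qed.

Lemma complex_path_swap m Z s t :
  complex_path Z m s t ->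
  complex_path (swap_curve Z) m (swap_state s) (swap_state t).
Proof.
elim: m s => [s ->//|m IH s /= [u su ut]].
by exists (swap_state u); [exact: complex_step_swap|exact: IH].
Qed.

(** The condition on [rw] makes the curve smooth, without vertical tangent line,
    at all its points above z; the same is required at the values reached from
    z along isotropic lines of the two families in turn. *)
Fixpoint generic_start (rw rz : {poly C}) (Z : curve) (m : nat) (z : C) : Prop :=
  if m is m'.+1 then
    rw.[z] != 0 /\
    forall w, on_curve Z z w -> generic_start rz rw (swap_curve Z) m' w
  else True.

Lemma linear_growth_specialization_neq0 (p : {poly {poly C}}) (y : C) :
  linear_growth p -> map_poly (horner^~ y) p != 0.
Proof.
move=> [K HK]; apply/eqP => p0.
have H x : p.[x, y] = 0.
  have := horner_map (horner_eval y) p x%:P; rewrite /= /horner_eval hornerC => <-.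
  by rewrite p0 horner0.
have := HK (K * (1 + N y) + 1)%:C%C y (H _); rewrite modulus_real.
by have := ler_norm (K * (1 + N y) + 1); lra.
Qed.

Lemma horner_specialize (p : {poly {poly C}}) (x y : C) :
  (map_poly (horner^~ y) p).[x] = p.[x, y].
Proof.
by have := horner_map (horner_eval y) p x%:P; rewrite /= /horner_eval hornerC.
Qed.

(** Used to choose one radius for the finitely many limit vertices. *)
Lemma finite_min_eps (T : eqType) (s : seq T) (Q : T -> R -> Prop) :
  (forall x e e', Q x e -> 0 < e' <= e -> Q x e') ->
  (forall x, x \in s -> exists2 e, 0 < e & Q x e) ->
  exists2 e, 0 < e & forall x, x \in s -> Q x e.
Proof.
move=> mono; elim: s => [|a s IH] H; first by exists 1.
have [|e e0 He] := IH; first by move=> x xs; apply: H; rewrite inE xs orbT.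
have [d d0 Hd] := H a (mem_head _ _).
have m0 : 0 < Num.min d e by rewrite lt_min d0 e0.
exists (Num.min d e) => // x; rewrite inE => /predU1P[->|xs].
  by apply: mono Hd _; rewrite m0 ge_min lexx.
by apply: mono (He _ xs) _; rewrite m0 ge_min lexx orbT.
Qed.

(** Bounded points of the curve that are close to the line z = z0 are close to
    its intersection with this line: a root a of [growth_poly] on the line that
    is not on the curve has a neighbourhood without points of the curve. *)
Lemma curve_fibre_near (Z : curve) (z0 : C) (M e : R) :
  linear_growth (growth_poly (wcurve Z)) -> 0 < e ->
  exists2 d, 0 < d & forall z w, on_curve Z z w -> N (z - z0) < d -> N w <= M ->
    exists2 w0, on_curve Z z0 w0 & N (w - w0) < e.
Proof.
move=> lg e0; set f := growth_poly (wcurve Z).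
set p := map_poly (horner^~ z0) f.
have p0 : p != 0 by exact: linear_growth_specialization_neq0.
have [r rE] := closed_field_poly_normal p.
have root_r a : root p a = (a \in r).
  by rewrite {1}rE rootZ ?lead_coef_eq0 // root_prod_XsubC.
pose Q (a : C) (d : R) := forall z w, on_curve Z z w ->
  N (z - z0) < d -> N (w - a) < d ->
  exists2 w0, on_curve Z z0 w0 & N (w - w0) < e.
have [| |d d0 Hd] := @finite_min_eps _ r Q.
- move=> x a b Qa /andP[b0 ba] z w Zzw h1 h2; apply: (Qa z w) => //.
  + exact: lt_le_trans h1 ba.
  + exact: lt_le_trans h2 ba.
- move=> a _.
  have [Zc|noc] := pselect (on_curve Z z0 a).
    by exists e => // z w _ _ ?; exists a.
  suff [d d0 Hd] : exists2 d, 0 < d & forall z w, N (z - z0) < d ->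
      N (w - a) < d -> ~ on_curve Z z w.
    by exists d => // z w oc h1 h2; case: (Hd z w).
  have [q1|n1] := eqVneq (growth_poly (wcurve Z)).[a, z0] 0; last first.
    have [d d0 Hd] := poly2_closed n1; exists d => // z w h1 h2 [[c _] _].
    by have := Hd _ _ h2 h1; rewrite c eqxx.
  have [q2|n2] := eqVneq (tangent_poly (wcurve Z)).[a, z0] 0; last first.
    have [d d0 Hd] := poly2_closed n2; exists d => // z w h1 h2 [[_ c] _].
    by have := Hd _ _ h2 h1; rewrite c eqxx.
  have [q3|n3] := eqVneq (growth_poly (zcurve Z)).[z0, a] 0; last first.
    have [d d0 Hd] := poly2_closed n3; exists d => // z w h1 h2 [_ [c _]].
    by have := Hd _ _ h1 h2; rewrite c eqxx.
  have [q4|n4] := eqVneq (tangent_poly (zcurve Z)).[z0, a] 0; last first.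
    have [d d0 Hd] := poly2_closed n4; exists d => // z w h1 h2 [_ [_ c]].
    by have := Hd _ _ h1 h2; rewrite c eqxx.
  by case: noc; split; split.
have [d1 d10 H1] := root_near_small_value p0 d0.
have [K K0 HK] := poly2_lipschitz f (Num.max M (N z0 + 1)).
have q0 : 0 < d1 / (K + 1) by rewrite divr_gt0 //; lra.
exists (Num.min (Num.min d 1) (d1 / (K + 1))).
  by rewrite !lt_min d0 q0 ltr01.
move=> z w Zzw; rewrite !lt_min => /andP[/andP[zd z1] zq] wM.
have fz : f.[w, z] = 0 by case: Zzw => [[]].
have [|a ra wa] := H1 w.
  rewrite horner_specialize -[_.[_]]subr0 -fz.
  apply: (@le_lt_trans _ _ (K * N (z - z0))).
    have -> : N (z - z0) = N (w - w) + N (z0 - z).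
      by rewrite subrr modulus0 add0r modulusBC.
    apply: HK; rewrite le_max ?wM //; apply/orP; right.
      by lra.
    by have := modulus_sub_le z z0; lra.
  rewrite ltr_pdivlMr in zq; last lra.
  by have := modulus_ge0 (z - z0); nra.
by apply: (Hd a _ z w) wa => //; rewrite -root_r.
Qed.

(** One step turns a small [dz], with z near z0 and w bounded, into a small
    [dw], with w near some w0 and z bounded; exchanging z and w, the induction
    hypothesis then applies to the rest of the path. *)
Lemma complex_path_small (m : nat) : forall (Z : curve) (rw rz : {poly C}) (z0 : C),
  linear_growth (growth_poly (wcurve Z)) ->
  linear_growth (growth_poly (zcurve Z)) ->
  generically_smooth (tangent_poly (wcurve Z)) rw ->
  generically_smooth (tangent_poly (zcurve Z)) rz ->
  generic_start rw rz Z m z0 ->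
  forall M, exists2 e, 0 < e & forall s t,
    complex_path Z m s t -> dz s * dw s = 1 ->
    N (pz s - z0) < e -> N (pw s) <= M -> N (dz s) < e ->
    if odd m then N (dw t) < 1 else N (dz t) < 1.
Proof.
elim: m => [|m IH] Z rw rz z0 gw gz sw sz /=.
  by move=> _ M; exists 1 => // s t -> .
move=> [rz0 gen] M.
have [r rE] := closed_field_poly_normal
  (map_poly (horner^~ z0) (growth_poly (wcurve Z))).
have p0 := linear_growth_specialization_neq0 z0 gw.
have in_r a : on_curve Z z0 a -> a \in r.
  case=> [[fa _] _]; rewrite -root_prod_XsubC.
  have : root (map_poly (horner^~ z0) (growth_poly (wcurve Z))) a.
    by rewrite /root horner_specialize fa.
  by rewrite {1}rE rootZ ?lead_coef_eq0.
pose Q (a : C) (e : R) := on_curve Z z0 a -> forall s u t,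
  complex_step Z s u -> complex_path Z m u t -> dz s * dw s = 1 ->
  N (pz u - z0) < e -> N (pw u - a) < e -> N (dz s) < e ->
  if ~~ odd m then N (dw t) < 1 else N (dz t) < 1.
have [| |e0 e00 He0] := @finite_min_eps _ r Q.
- move=> x e e' Qx /andP[e'0 ee'] oc s u t su ut ds h1 h2 h3.
  by apply: (Qx oc s u t) => //; [move: h1|move: h2|move: h3] => /lt_le_trans; apply.
- move=> a _; have [Zc|noc] := pselect (on_curve Z z0 a); last by exists 1.
  have [e1 e10 He1] := IH (swap_curve Z) rz rw a gz gw sz sw (gen a Zc) (N z0 + 1).
  set h := tangent_poly (wcurve Z) in sw *.
  have hn0 : h^`().[a, z0] != 0 by apply: sw => //; case: Zc => [[]].
  have [d d0 Hd] := poly2_nonzero_near hn0.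
  have [B B0 HB] := poly2_bounded (map_poly (@deriv C) h) (N a + N z0 + 1).
  set c := N h^`().[a, z0] / 2 in Hd.
  have c0 : 0 < c by rewrite divr_gt0 // modulus_gt0.
  have q0 : 0 < e1 * c / (B + 1) by apply: divr_gt0; [exact: mulr_gt0|lra].
  exists (Num.min (Num.min d e1) (Num.min 1 (e1 * c / (B + 1)))).
    by rewrite !lt_min d0 e10 q0 ltr01.
  move=> _ s u t su ut ds; rewrite !lt_min.
  move=> /andP[/andP[zd ze] /andP[z1 _]] /andP[/andP[wd we] /andP[w1 _]].
  move=> /andP[_ /andP[_ dsmall]].
  case: (su) => nz [nw [nn ocu [tw _] _ [dzu dwu]]].
  have [_ hc] := Hd _ _ wd zd.
  have hB : N (map_poly (@deriv C) h).[pw u, pz u] <= B.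
    apply: HB.
      by have := modulus_sub_le (pw u) a; have := modulus_ge0 z0; lra.
    by have := modulus_sub_le (pz u) z0; have := modulus_ge0 a; lra.
  (* Tangency times nw, with nz * nw = 1: this bounds nw ^+ 2, hence dw u. *)
  have E : h^`().[pw u, pz u] * nw ^+ 2 = - (map_poly (@deriv C) h).[pw u, pz u].
    move: tw; rewrite /tangent_half -/h => tw.
    have /eqP := congr1 (fun x => x * nw) tw.
    rewrite mul0r mulrDl -mulrA -mulrA nn mulr1 addr_eq0 => /eqP <-.
    by rewrite expr2.
  have /(congr1 N) := E; rewrite modulusN modulusM => EN.
  have small : N (dw u) < e1.
    rewrite dwu modulusM.
    have nwB : c * N (nw ^+ 2) <= B.
      apply: le_trans hB; rewrite -EN; apply: ler_wpM2r => //.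
      exact: modulus_ge0.
    rewrite ltr_pdivlMr in dsmall; last lra.
    have ndz := modulus_ge0 (dz s).
    have h3 := ler_wpM2r ndz nwB.
    rewrite -(ltr_pM2l c0); lra.
  have := He1 (swap_state u) (swap_state t) (complex_path_swap ut).
  rewrite /= -if_neg; apply => //.
    rewrite dzu dwu; have -> : nw ^+ 2 * dz s * (nz ^+ 2 * dw s) =
      (nz * nw) ^+ 2 * (dz s * dw s) by ring.
    by rewrite nn ds expr1n mulr1.
  by have := modulus_sub_le (pz u) z0; lra.
have [K0 HK0] := gw.
have [K KK0 HK] : exists2 K, 0 <= K &
    forall x y, (growth_poly (wcurve Z)).[x, y] = 0 -> N x <= K * (1 + N y).
  exists (Num.max 0 K0); first by rewrite le_max lexx.
  move=> x y /HK0 /le_trans; apply; apply: ler_wpM2r.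
    by have := modulus_ge0 y; lra.
  by rewrite le_max lexx orbT.
pose M' := Num.max 0 M.
have M'0 : 0 <= M' by rewrite le_max lexx.
pose W := 2 * K * (2 + N z0 + M').
have Nz0 := modulus_ge0 z0.
have W0 : 0 <= W by rewrite !mulr_ge0 //; lra.
have [d d0 Hd] := curve_fibre_near z0 W gw e00.
pose b := Num.min d e0.
have b0 : 0 < b by rewrite lt_min d0 e00.
have q0 : 0 < b / (2 + W + M') by rewrite divr_gt0 //; lra.
have q1 : 0 < (2 * (K + 1))^-1 by rewrite invr_gt0; lra.
exists (Num.min (Num.min 1 e0) (Num.min (b / (2 + W + M')) (2 * (K + 1))^-1)).
  by rewrite !lt_min q0 q1 e00 ltr01.
move=> s t [u su ut] ds; rewrite !lt_min.
move=> /andP[/andP[z1 _] /andP[zb _]] wM /andP[/andP[l1 le0] /andP[lb lK]].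
have wM' : N (pw s) <= M' by rewrite le_max wM orbT.
case: (su) => nz [nw [_ ocu _ edge _]].
(* The edge relation times dz s: along an almost isotropic edge z hardly
   changes, provided that w stays bounded. *)
have edge2 : pz u - pz s = dz s ^+ 2 * (pw u - pw s).
  by rewrite expr2 -mulrA -edge mulrA ds mul1r.
have Nedge : N (pz u - pz s) <= N (dz s) ^+ 2 * (N (pw u) + N (pw s)).
  rewrite edge2 modulusM modulusX; apply: ler_wpM2l; last exact: modulusB.
  by rewrite exprn_ge0 // modulus_ge0.
set l := N (dz s) in l1 le0 lb lK Nedge.
have l0 : 0 <= l by exact: modulus_ge0.
have ll : l ^+ 2 <= l by rewrite expr2 ler_piMl // ltW.
set w' := N (pw u) in Nedge.
have w'0 : 0 <= w' by exact: modulus_ge0.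
have Nedge' : N (pz u - pz s) <= l * (w' + M').
  apply: (le_trans Nedge); apply: ler_pM => //; last lra.
  - by rewrite exprn_ge0.
  - by rewrite addr_ge0 // modulus_ge0.
have lK' : l * (K + 1) <= 2^-1.
  by rewrite invfM ltr_pdivlMr in lK; [exact: ltW|lra].
have zu : N (pz u) <= N z0 + 1 + l * (w' + M').
  have := modulus_sub_le (pz u) (pz s); have := modulus_sub_le (pz s) z0; lra.
(* The linear growth bounds w' by itself times a factor at most 1/2. *)
have wW : w' <= W.
  have : w' <= K * (1 + N (pz u)) by apply: HK; case: ocu => [[]].
  have := ler_wpM2l KK0 zu.
  have : K * l * w' <= 2^-1 * w' by apply: ler_wpM2r => //; lra.
  have : K * (l * M') <= K * M'.
    by apply: ler_wpM2l => //; rewrite ler_piMl // ltW.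
  rewrite /W; nra.
have zub : N (pz u - z0) < b.
  have h1 : l * (w' + M') <= l * (W + M') by apply: ler_wpM2l => //; lra.
  have h2 : N (pz u - z0) <= N (pz u - pz s) + N (pz s - z0).
    by have := modulusD (pz u - pz s) (pz s - z0); rewrite addrA subrK.
  rewrite ltr_pdivlMr in lb; last lra.
  rewrite ltr_pdivlMr in zb; last lra.
  have := modulus_ge0 (pz s - z0).
  nra.
rewrite lt_min in zub; case/andP: zub => zud zue.
have [w0 oc0 w0e] := Hd _ _ ocu zud wW.
exact: (He0 w0 (in_r _ oc0) oc0 s u t).
Qed.

Lemma no_small_odd_cycle (m : nat) (Z : curve) (rw rz : {poly C}) (z0 w0 : C) :
  linear_growth (growth_poly (wcurve Z)) ->
  linear_growth (growth_poly (zcurve Z)) ->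
  generically_smooth (tangent_poly (wcurve Z)) rw ->
  generically_smooth (tangent_poly (zcurve Z)) rz ->
  odd m -> generic_start rw rz Z m z0 ->
  exists2 e, 0 < e & forall l l', l * l' = 1 -> N l < e ->
    ~ complex_path Z m (State z0 w0 l l') (State z0 w0 l l').
Proof.
move=> gw gz sw sz om gen.
have [e e0 He] := complex_path_small gw gz sw sz gen (N w0).
exists (Num.min 1 e) => [|l l' ll]; first by rewrite lt_min ltr01.
rewrite lt_min => /andP[l1 le] pth.
have := He _ _ pth ll; rewrite /= subrr modulus0 om => /(_ e0 (lexx _) le) l'1.
have := congr1 N ll; rewrite modulusM modulus1.
have := modulus_ge0 l; have := modulus_ge0 l'; nra.
Qed.

(** A bad z is a root of [rw], or lies on the curve with one of the finitely
    many bad w of the previous stage; the growth of [zcurve] makes the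
    horizontal fibres finite. *)
Lemma generic_start_cofinite (m : nat) : forall (Z : curve) (rw rz : {poly C}),
  linear_growth (growth_poly (wcurve Z)) ->
  linear_growth (growth_poly (zcurve Z)) -> rw != 0 -> rz != 0 ->
  exists s : seq C, forall z, z \notin s -> generic_start rw rz Z m z.
Proof.
elim: m => [|m IH] Z rw rz gw gz rw0 rz0; first by exists [::].
have [s Hs] := IH (swap_curve Z) rz rw gz gw rz0 rw0.
have [r rE] := closed_field_poly_normal rw.
pose fib w := sval (closed_field_poly_normal
  (map_poly (horner^~ w) (growth_poly (zcurve Z)))).
exists (r ++ flatten (map fib s)) => z.
rewrite mem_cat negb_or => /andP[zr zf] /=; split.
  apply: contra zr => zr.
  have : root rw z by [].
  by rewrite {1}rE rootZ ?lead_coef_eq0 // root_prod_XsubC.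
move=> w oc; apply: Hs; apply: contra zf => ws.
apply/flattenP; exists (fib w); first exact: map_f.
rewrite -root_prod_XsubC /fib; case: closed_field_poly_normal => /= r' r'E.
have p0 := linear_growth_specialization_neq0 w gz.
have : root (map_poly (horner^~ w) (growth_poly (zcurve Z))) z.
  by rewrite /root horner_specialize; case: oc => _ [-> _].
by rewrite {1}r'E rootZ ?lead_coef_eq0.
Qed.
End Dynamics.

(** * Squarefree part with respect to the outer variable *)
Section SquarefreePart.

(** The quotient of p by a common divisor g of p and p' keeps all the roots of
    p: a root of p is a root of p' with multiplicity one less. *)
Lemma squarefree_quotient_root (F : numFieldType) (p k k' g : {poly F}) (a b x : F) :
  p != 0 -> a != 0 -> b != 0 ->
  a *: p = k * g -> b *: p^`() = k' * g -> root p x -> root k x.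
Proof.
move=> p0 a0 b0 ea eb px; have [m [q]] := multiplicity_XsubC p x.
rewrite p0 /= => qx pE.
case: m pE => [|m] pE; first by rewrite pE expr0 mulr1 (negPf qx) in px.
apply: contraNT qx => kx; set X := 'X - x%:P in pE.
have Xg : X ^+ m.+1 %| g.
  have : X ^+ m.+1 %| k * g by rewrite -ea dvdpZr // pE dvdp_mull.
  rewrite Gauss_dvdpr // coprimep_expl // coprimep_sym.
  by rewrite coprimep_XsubC.
have : X ^+ m.+1 %| p^`() by rewrite -(dvdpZr _ _ b0) eb dvdp_mull.
rewrite pE derivM deriv_exp derivXsubC mul1r /= dvdp_addr; last first.
  exact: dvdp_mull.
rewrite mulrnAr -scaler_nat dvdpZr ?pnatr_eq0 // exprS.
by rewrite dvdp_mul2r ?dvdp_XsubCl // expf_neq0 // polyXsubC_eq0.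
Qed.

(** The quotient of f by the gcd of f and its derivative is coprime to its own
    derivative over the fraction field of the coefficients, and r is the
    constant of a Bezout relation.  It keeps the zeros of f except on finitely
    many lines y = constant, the roots of c, where the leading coefficients of
    the pseudo-divisions vanish. *)
Lemma squarefree_part (R : rcfType) (f : {poly {poly R[i]}}) : f != 0 ->
  exists h r c, [/\ r != 0, c != 0, generically_smooth h r &
    forall x y, c.[y] != 0 -> f.[x, y] = 0 -> h.[x, y] = 0].
Proof.
move=> f0; set g := gcdp f f^`(); pose h := f %/ g.
have ef := Pdiv.Idomain.divpK (dvdp_gcdl f f^`()).
have ef' := Pdiv.Idomain.divpK (dvdp_gcdr f f^`()).
rewrite -/g in ef ef'; set c1 := _ ^+ _ in ef; set c2 := _ ^+ _ in ef'.
have lg0 : lead_coef g != 0 by rewrite lead_coef_eq0 gcdp_eq0 negb_and f0.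
have sep : coprimep h h^`() by have := make_separable f0; rewrite separable_poly.unlock.
have [[u v] /= uv] := Pdiv.Idomain.Bezoutp h h^`().
have : size (u * h + v * h^`()) == 1 by rewrite (eqp_size uv).
move=> /size_poly1P[r r0 rE].
exists h, r, (c1 * c2 * lead_coef f); split => //.
- by rewrite !mulf_neq0 ?lead_coef_eq0 // expf_neq0.
- move=> x y ry hxy; apply: contraNneq ry => h'xy.
  have := congr1 (fun p => p.[x, y]) rE.
  by rewrite !hornerE hxy h'xy !mulr0 addr0 => <-.
- move=> x y; rewrite !hornerM !mulf_eq0 !negb_or => /andP[/andP[c1y c2y] ly] fxy.
  pose phi := map_poly (horner_eval y).
  have hphi p : (phi p).[x] = p.[x, y] by rewrite -horner_specialize.
  suff : root (phi h) x by rewrite /root hphi => /eqP.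
  apply: (@squarefree_quotient_root _ (phi f) _ (phi (f^`() %/ g)) (phi g)
    c1.[y] c2.[y]) => //.
  + apply: contraNneq ly => /(congr1 (fun p : {poly R[i]} => p`_(size f).-1)).
    by rewrite coef_map coef0 /= /horner_eval => <-.
  + by rewrite -[c1.[y]]/(horner_eval y c1) -map_polyZ -ef rmorphM.
  + by rewrite deriv_map -[c2.[y]]/(horner_eval y c2) -map_polyZ -ef' rmorphM.
  + by rewrite /root hphi fxy.
Qed.
End SquarefreePart.

(** * Closed complex orbits as a constructible set *)
Lemma closed_field_quantifier_elim (F : closedFieldType) (f : GRing.formula F) :
  exists2 g : GRing.formula F, GRing.qf_form g && GRing.rformula g &
    forall e, GRing.qf_eval e g <-> GRing.holds e f.
Proof.
have wf := @ClosedFieldQE.wf_ex_elim F.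
have ok := ClosedFieldQE.holds_ex_elim (@GRing.solve_monicpoly F).
have rf := GRing.to_rform_rformula f.
exists (GRing.quantifier_elim (@ClosedFieldQE.ex_elim F) (GRing.to_rform f)).
  exact: GRing.quantifier_elim_wf.
move=> e; split.
  by move=> /(GRing.quantifier_elim_rformP wf ok _ rf) /GRing.to_rformP.
by move=> /GRing.to_rformP /(GRing.quantifier_elim_rformP wf ok _ rf).
Qed.

Section OneVariable.
Variable F : fieldType.

Lemma rterm_polynomial (z w : F) (t : GRing.term F) : GRing.rterm t ->
  exists q : {poly F}, forall l, GRing.eval [:: z; w; l] t = q.[l].
Proof.
elim: t => //=.
- case=> [|[|[|i]]] _; [exists z%:P|exists w%:P|exists 'X|exists 0] => l;
    by rewrite /= ?hornerE // nth_nil.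
- by move=> x _; exists x%:P => l; rewrite hornerC.
- by move=> n _; exists n%:R%:P => l; rewrite hornerC.
- move=> a IHa b IHb /andP[/IHa[p Hp] /IHb[q Hq]].
  by exists (p + q) => l; rewrite hornerD Hp Hq.
- by move=> a IHa /IHa[p Hp]; exists (- p) => l; rewrite hornerN Hp.
- by move=> a IHa n /IHa[p Hp]; exists (p *+ n) => l; rewrite hornerMn Hp.
- move=> a IHa b IHb /andP[/IHa[p Hp] /IHb[q Hq]].
  by exists (p * q) => l; rewrite hornerM Hp Hq.
- by move=> a IHa n /IHa[p Hp]; exists (p ^+ n) => l; rewrite horner_exp Hp.
Qed.

(** Constructible subsets of the line are finite or cofinite. *)
Lemma qf_form_generic_value (z w : F) (f : GRing.formula F) :
  GRing.qf_form f -> GRing.rformula f ->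
  exists2 p : {poly F}, p != 0 &
    exists b, forall l, p.[l] != 0 -> GRing.qf_eval [:: z; w; l] f = b.
Proof.
elim: f => //=.
- by move=> b _ _; exists 1; [exact: oner_neq0|exists b].
- move=> s t _ /andP[/(rterm_polynomial z w)[p Hp] /(rterm_polynomial z w)[q Hq]].
  have [pq|pq] := eqVneq p q.
    exists 1; first exact: oner_neq0.
    by exists true => l _; rewrite Hp Hq pq eqxx.
  exists (p - q); first by rewrite subr_eq0.
  exists false => l; rewrite hornerD hornerN subr_eq0 => /negPf pql.
  by rewrite Hp Hq.
- move=> f IHf g IHg /andP[qf qg] /andP[rf rg].
  have [p p0 [b Hb]] := IHf qf rf; have [q q0 [c Hc]] := IHg qg rg.
  exists (p * q); first by rewrite mulf_neq0.
  exists (b && c) => l; rewrite hornerM mulf_eq0 negb_or => /andP[/Hb -> /Hc ->].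
  by [].
- move=> f IHf g IHg /andP[qf qg] /andP[rf rg].
  have [p p0 [b Hb]] := IHf qf rf; have [q q0 [c Hc]] := IHg qg rg.
  exists (p * q); first by rewrite mulf_neq0.
  exists (b || c) => l; rewrite hornerM mulf_eq0 negb_or => /andP[/Hb -> /Hc ->].
  by [].
- move=> f IHf g IHg /andP[qf qg] /andP[rf rg].
  have [p p0 [b Hb]] := IHf qf rf; have [q q0 [c Hc]] := IHg qg rg.
  exists (p * q); first by rewrite mulf_neq0.
  exists (b ==> c) => l; rewrite hornerM mulf_eq0 negb_or => /andP[/Hb -> /Hc ->].
  by [].
- move=> f IHf qf rf; have [p p0 [b Hb]] := IHf qf rf.
  by exists p => //; exists (~~ b) => l /Hb ->.
Qed.
End OneVariable.

Section PathFormula.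
Variable R : rcfType.
Local Notation C := R[i].
Local Notation term := (GRing.term C).
Local Notation "''X_' i" := (@GRing.Var C i) (at level 8, i at level 2).

Definition poly_term (p : {poly C}) (x : term) : term :=
  foldr (fun c t => t * x + c%:T)%T (GRing.Const 0) p.

Definition poly2_term (p : {poly {poly C}}) (x y : term) : term :=
  foldr (fun (c : {poly C}) t => t * x + poly_term c y)%T (GRing.Const 0) p.

Lemma eval_poly_term e p x :
  GRing.eval e (poly_term p x) = p.[GRing.eval e x].
Proof.
rewrite /horner /poly_term; elim: (polyseq p) => //= c s -> //.
Qed.

Lemma eval_poly2_term e p x y :
  GRing.eval e (poly2_term p x y) = p.[GRing.eval e x, GRing.eval e y].
Proof.
rewrite /poly2_term [p.[_]]/horner; elim: (polyseq p) => /= [|c s ->].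
  by rewrite horner0.
by rewrite hornerD hornerM hornerC eval_poly_term.
Qed.

Definition env_state (e : seq C) (b : nat) : state R :=
  State e`_b e`_b.+1 e`_b.+2 e`_b.+3.

Definition on_half_form (h : half_curve R) (x y : term) : GRing.formula C :=
  (poly2_term (growth_poly h) x y == 0 /\ poly2_term (tangent_poly h) x y == 0)%T.

Definition tangent_half_form (h : half_curve R) (x y dx dy : term) :
    GRing.formula C :=
  (poly2_term (tangent_poly h)^`() x y * dx +
   poly2_term (map_poly (@deriv C) (tangent_poly h)) x y * dy == 0)%T.

Definition step_form (Z : curve R) (a b : nat) : GRing.formula C :=
  let nz := 'X_(b + 4) in let nw := 'X_(b + 5) in
  let z := 'X_b in let w := 'X_b.+1 in
  (nz * nw == 1 /\
   ((on_half_form (wcurve Z) w z /\ on_half_form (zcurve Z) z w) /\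
   ((tangent_half_form (wcurve Z) w z nw nz /\
     tangent_half_form (zcurve Z) z w nz nw) /\
   ('X_a.+3 * (z - 'X_a) == 'X_a.+2 * (w - 'X_a.+1) /\
   ('X_b.+2 == nz ^+ 2 * 'X_a.+3 /\ 'X_b.+3 == nw ^+ 2 * 'X_a.+2)))))%T.

(** The current state is at the variables a to a + 3 and the final state is
    always at 0 to 3; b is the first fresh variable, and each step binds six
    variables: the new state and the unit tangent vector. *)
Fixpoint path_form (Z : curve R) (m a b : nat) : GRing.formula C :=
  if m is m'.+1 then
    foldr GRing.Exists (step_form Z a b /\ path_form Z m' b (b + 6))%T (iota b 6)
  else ('X_a == 'X_0 /\ ('X_a.+1 == 'X_1 /\
        ('X_a.+2 == 'X_2 /\ 'X_a.+3 == 'X_3)))%T.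

Lemma env_update (e : seq C) (b : nat) (v : seq C) :
  exists2 e' : seq C, forall i, i \notin iota b (size v) -> e'`_i = e`_i &
    forall i, (i < size v)%N -> e'`_(b + i) = v`_i.
Proof.
exists (mkseq (fun i => if i \in iota b (size v) then v`_(i - b) else e`_i)
  (size e + (b + size v))) => [i|i iv].
  case: (ltnP i (size e + (b + size v))) => ib.
    by rewrite nth_mkseq // => /negPf ->.
  rewrite nth_default ?size_mkseq // => _; rewrite nth_default //.
  exact: leq_trans (leq_addr _ _) ib.
rewrite nth_mkseq; last by rewrite addnCA ltn_add2l ltn_addl.
by rewrite mem_iota leq_addr ltn_add2l iv addKn.
Qed.

Lemma step_formP e Z a b : GRing.holds e (step_form Z a b) ->
  complex_step Z (env_state e a) (env_state e b).
Proof.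
rewrite /= !eval_poly2_term /=.
move=> [n1 [[[? ?] [? ?]] [[? ?] [? [? ?]]]]].
by exists e`_(b + 4), e`_(b + 5).
Qed.

Lemma holds_path_form Z m : forall e a b, (a + 4 <= b)%N -> (4 <= b)%N ->
  GRing.holds e (path_form Z m a b) <->
  complex_path Z m (env_state e a) (env_state e 0).
Proof.
elim: m => [|m IH] e a b ab b4.
  by split=> /= [[? [? [? ?]]]|[? ? ? ?] //]; rewrite /env_state; congr State.
have far e' i : {in [predC iota b 6], GRing.same_env e e'} ->
    (i + 4 <= b)%N -> env_state e' i = env_state e i.
  move=> ee ib; have ee' j : (j < b)%N -> e'`_j = e`_j.
    move=> jb; rewrite ee //; change (j \notin iota b 6).
    by rewrite mem_iota negb_and -ltnNge jb.
  rewrite /env_state !ee' //; lia.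
rewrite [path_form _ _ _ _]/=; split.
  move=> /(GRing.foldExistsP _ (iota b 6))[e' ee [/step_formP st]].
  move=> /IH pth; exists (env_state e' b).
    by rewrite -(far e' a).
  by rewrite -(far e' 0) //; apply: pth; lia.
move=> [u [nz [nw [nn [Zc1 Zc2] [t1 t2] edge [d1 d2]]]] pth].
apply/(GRing.foldExistsP _ (iota b 6)).
have [e' e1 e2] := env_update e b [:: pz u; pw u; dz u; dw u; nz; nw].
have ee : {in [predC iota b 6], GRing.same_env e e'}.
  by move=> i; rewrite inE => /e1 ->.
have eb : env_state e' b = u.
  have := (e2 0 isT, e2 1 isT, e2 2 isT, e2 3 isT); rewrite !addnS addn0 /=.
  by rewrite /env_state => -[[[-> ->] ->] ->]; case: (u).
exists e' => //; split; last first.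
  apply/IH; [lia|lia|].
  by rewrite eb far.
have [enz enw] : e'`_(b + 4) = nz /\ e'`_(b + 5) = nw by split; rewrite e2.
have ea := far _ _ ee ab.
subst u; rewrite -{}ea -{}enz -{}enw in nn t1 t2 edge d1 d2.
case: Zc1 => ? ?; case: Zc2 => ? ?.
by rewrite /= !eval_poly2_term /=; do !split.
Qed.

Lemma cycle_quantifier_elim (Z : curve R) (m : nat) :
  exists2 f : GRing.formula C, GRing.qf_form f && GRing.rformula f &
    forall z w l, GRing.qf_eval [:: z; w; l] f <->
      exists2 l', l * l' = 1 &
        complex_path Z m (State z w l l') (State z w l l').
Proof.
have [f fok Hf] := closed_field_quantifier_elim
  ('exists 'X_3, 'X_2 * 'X_3 == 1 /\ path_form Z m 0 4)%T.
exists f => // z w l; split.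
  move=> /Hf[l'] /=[e /holds_path_form pth].
  by exists l' => //; exact: pth.
move=> [l' e pth]; apply/Hf; exists l'; split=> //.
exact/holds_path_form.
Qed.
End PathFormula.

Section CycleDirections.
Variable R : rcfType.
Local Notation C := R[i].
Local Notation N := (@modulus R).

Lemma nonroot_near0 (p : {poly C}) (e : R) : p != 0 -> 0 < e ->
  exists l, [/\ l != 0, N l < e & p.[l] != 0].
Proof.
move=> p0 e0; pose c (n : nat) : C := (e / n.+2%:R)%:C%C.
have c_pos n : 0 < e / n.+2%:R by rewrite divr_gt0.
have c_inj : injective c.
  move=> m n /complexI /(mulfI (lt0r_neq0 e0)) /invr_inj /eqP.
  by rewrite eqr_nat => /eqP [].
have [/allP H|/allPn[_ /mapP[n _ ->] cn]] :=
    boolP (all (root p) (map c (iota 0 (size p)))).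
  have := max_poly_roots p0 (introT allP H).
  by rewrite map_inj_uniq // iota_uniq size_map size_iota ltnn => /(_ isT).
exists (c n); split => //.
  by rewrite -modulus_eq0 modulus_real normr_eq0 lt0r_neq0.
by rewrite modulus_real gtr0_norm // ltr_pdivrMr // ltr_pMr // ltr1n.
Qed.

(** The generic value of the formula cannot be true, as it would then be true
    for some arbitrarily small nonzero l. *)
Lemma cycle_direction_root (Z : curve R) (m : nat) (rw rz : {poly C})
    (f : GRing.formula C) (z w : C) :
  linear_growth (growth_poly (wcurve Z)) ->
  linear_growth (growth_poly (zcurve Z)) ->
  generically_smooth (tangent_poly (wcurve Z)) rw ->
  generically_smooth (tangent_poly (zcurve Z)) rz ->
  odd m -> generic_start rw rz Z m z ->
  GRing.qf_form f && GRing.rformula f ->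
  (forall l, GRing.qf_eval [:: z; w; l] f -> exists2 l', l * l' = 1 &
     complex_path Z m (State z w l l') (State z w l l')) ->
  exists2 p : {poly C}, p != 0 &
    forall l, GRing.qf_eval [:: z; w; l] f -> root p l.
Proof.
move=> gw gz sw sz om gen /andP[qf rf] Hf.
have [p p0 [b Hb]] := qf_form_generic_value z w qf rf.
have [e e0 He] := no_small_odd_cycle w gw gz sw sz om gen.
exists p => // l fl; apply: contraT => pl.
have [l1 [l10 l1e pl1]] := nonroot_near0 p0 e0.
have : GRing.qf_eval [:: z; w; l1] f by rewrite (Hb _ pl1) -(Hb _ pl).
by move=> /Hf[l' ll pth]; case: (He l1 l').
Qed.
End CycleDirections.

(** * Avoiding an isotropic point at infinity *)
Section Growth.
Variable R : realType.
Local Notation C := R[i].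
Local Notation N := (@modulus R).

Lemma meval_substitution (n : nat) (v : 'I_n -> {poly {poly C}}) (F : mpoly.mpoly n C) :
  exists f : {poly {poly C}}, forall x y,
    f.[x, y] = mpoly.meval (fun i => (v i).[x, y]) F.
Proof.
exists (\sum_(m <- mpoly.msupp F) (mpoly.mcoeff m F)%:P%:P * \prod_(i < n) v i ^+ m i).
move=> x y; rewrite mpoly.mevalE horner_sum horner_sum; apply: eq_bigr => m _.
rewrite !hornerM !hornerC; congr (_ * _).
rewrite !horner_prod; apply: eq_bigr => i _.
by rewrite !horner_exp.
Qed.

Lemma heval_scale (d : nat) (F : mpoly.mpoly 3 C) (c : C) (z : 'rV[C]_3) :
  F \is mpoly.ishomog1 d mpoly.mdeg -> heval F (c *: z) = c ^+ d * heval F z.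
Proof.
move=> /mpoly.dhomogP homF; rewrite /heval !mpoly.mevalE mulr_sumr.
rewrite big_seq [RHS]big_seq; apply: eq_bigr => m /homF /= <-.
rewrite mulrCA; congr (_ * _).
rewrite mpoly.mdegE -prodrXr -big_split /=; apply: eq_bigr => i _.
by rewrite mxE exprMn.
Qed.

(** Some homogeneous F vanishes on S and not at the point (1 : iota : 0).  In the
    isotropic coordinates x = X - iota Y and y = X + iota Y this point is the
    point at infinity (1 : 0 : 0) of the x-axis.  So F does not vanish at
    (x : y : 1) = (1 : y/x : 1/x) when y/x and 1/x are small, which leaves |x|
    at most a constant times 1 + |y| on the zero set. *)
Lemma isotropic_growth (S : set (R * R)) (iota : C) : iota ^+ 2 = -1 ->
  ~ zariski_closure S (hcoord 1 iota 0) ->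
  exists f : {poly {poly C}}, linear_growth f /\
    forall p, S p -> f.[p.1%:C%C - iota * p.2%:C%C, p.1%:C%C + iota * p.2%:C%C] = 0.
Proof.
move=> ii notin.
have i0 : iota != 0.
  by apply: contra_eq_neq ii => ->; rewrite expr0n /= eq_sym oppr_eq0 oner_neq0.
have [d [F [homF FS FI]]] : exists d F, [/\ F \is mpoly.ishomog1 d mpoly.mdeg,
    forall p, S p -> heval F (real_point p) = 0 & heval F (hcoord 1 iota 0) != 0].
  apply: boolp.contrapT => H; apply: notin; split.
    apply/eqP => /rowP /(_ 0); rewrite !mxE /= => /eqP.
    by rewrite oner_eq0.
  move=> d F homF FS; apply: boolp.contrapT => /eqP FI; apply: H.
  by exists d, F.
pose b : C := (2 * iota)^-1.
have two0 : (2 : C) != 0 by rewrite pnatr_eq0.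
have [f Hf] := meval_substitution (fun i : 'I_3 =>
  [:: 2^-1%:P%:P * ('X + 'X%:P); b%:P%:P * ('X%:P - 'X); 1]`_i) F.
have {}Hf x y : f.[x, y] = heval F (hcoord (2^-1 * (x + y)) (b * (y - x)) 1).
  rewrite Hf; apply: mpoly.meval_eq => -[[|[|[|//]]] ?]; rewrite !mxE /=;
  by rewrite !(hornerM, hornerD, hornerN, hornerC, hornerX).
(* The same form in the chart at infinity, with coordinates y/x and 1/x. *)
have [g Hg] := meval_substitution (fun i : 'I_3 =>
  [:: 2^-1%:P%:P * (1 + 'X); b%:P%:P * ('X - 1); 'X%:P]`_i) F.
have {}Hg x y : g.[x, y] = heval F (hcoord (2^-1 * (1 + x)) (b * (x - 1)) y).
  rewrite Hg; apply: mpoly.meval_eq => -[[|[|[|//]]] ?]; rewrite !mxE /=;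
  by rewrite !(hornerM, hornerD, hornerN, hornerC, hornerX).
exists f; split; last first.
  move=> p /FS <-; rewrite Hf /real_point; congr (heval F (hcoord _ _ _)).
    by field.
  by rewrite /b; field.
have g00 : g.[0, 0] != 0.
  rewrite Hg; have -> : hcoord (2^-1 * (1 + 0)) (b * (0 - 1)) 0 =
      2^-1 *: hcoord 1 iota 0.
    apply/rowP => -[[|[|[|//]]] ?]; rewrite !mxE /= ?addr0 ?mulr0 //.
    rewrite /b sub0r mulrN1 invfM -mulrN; congr (_ * _).
    apply: (mulfI i0); rewrite -expr2 ii mulrN divff //.
  by rewrite (heval_scale _ _ homF) mulf_neq0 // expf_neq0 // invr_eq0.
have [e e0 He] := poly2_closed g00.
exists e^-1 => x y fxy; have Ny := modulus_ge0 y.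
rewrite ler_pdivlMl //.
have [small|big] := leP (e * N x) 1; first by lra.
have Nx0 : 0 < N x by rewrite -(pmulr_rgt0 _ e0); lra.
have x0 : x != 0 by rewrite -modulus_gt0.
suff : ~~ (N (y / x) < e).
  by rewrite -leNgt modulusM modulusV ler_pdivlMr //; lra.
apply/negP => yx.
have gz : g.[y / x, x^-1] = 0.
  rewrite Hg -(mulr0 (x^-1 ^+ d)) -fxy Hf -(heval_scale _ _ homF).
  congr (heval F _); apply/rowP => -[[|[|[|//]]] ?]; rewrite !mxE /=.
  - by field.
  - by rewrite /b; field; rewrite i0.
  - by rewrite mulr1.
have xe : N x^-1 < e by rewrite modulusV -[ltLHS]mul1r ltr_pdivrMr.
by have := He (y / x) x^-1; rewrite !subr0 gz eqxx => /(_ yx xe).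
Qed.
End Growth.

(** * The boundary in isotropic coordinates *)
Section Boundary.
Variable R : realType.
Local Notation C := R[i].
Local Notation N := (@modulus R).
Implicit Types p q : R * R.

Definition zcoord (p : R * R) : C := Complex p.1 p.2.
Definition wcoord (p : R * R) : C := Complex p.1 (- p.2).

Lemma zcoordE p : zcoord p = p.1%:C%C + 'i%C * p.2%:C%C.
Proof.
apply/eqP; rewrite eq_complex /=.
by rewrite !(mul0r, mul1r, mulr0, addr0, subr0, add0r, oppr0) !eqxx.
Qed.

Lemma wcoordE p : wcoord p = p.1%:C%C - 'i%C * p.2%:C%C.
Proof.
apply/eqP; rewrite eq_complex /=.
by rewrite !(mul0r, mul1r, mulr0, addr0, subr0, add0r, oppr0) !eqxx.
Qed.

Lemma zcoord_inj : injective zcoord.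
Proof. by move=> [a b] [c d] [/= -> ->]. Qed.

Lemma wcoord_inj : injective wcoord.
Proof. by move=> [a b] [c d] [/= -> /oppr_inj ->]. Qed.

Lemma linear_growthM (f g : {poly {poly C}}) :
  linear_growth f -> linear_growth g -> linear_growth (f * g).
Proof.
move=> [K HK] [L HL]; exists (Num.max K L) => x y.
have y1 : 0 <= 1 + N y by have := modulus_ge0 y; lra.
rewrite !hornerM => /eqP; rewrite mulf_eq0 => /orP[/eqP/HK|/eqP/HL] h.
  by apply: (le_trans h); apply: ler_wpM2r => //; rewrite le_max lexx.
by apply: (le_trans h); apply: ler_wpM2r => //; rewrite le_max lexx orbT.
Qed.

Lemma linear_growth1 : linear_growth (1 : {poly {poly C}}).
Proof. by exists 0 => x y /eqP; rewrite !hornerC oner_eq0. Qed.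

Lemma pieces_half_curve (n : nat) (piece : 'I_n -> regular_arc R) (iota : C) :
  iota ^+ 2 = -1 ->
  (forall j, ~ complexification (piece j) (hcoord 1 iota 0)) ->
  exists (h : half_curve R) (r c : {poly C}),
    [/\ linear_growth (growth_poly h), r != 0, c != 0,
        generically_smooth (tangent_poly h) r &
    forall j p, arc_image (piece j) p ->
    let x := p.1%:C%C - iota * p.2%:C%C in let y := p.1%:C%C + iota * p.2%:C%C in
    (growth_poly h).[x, y] = 0 /\ (c.[y] != 0 -> (tangent_poly h).[x, y] = 0)].
Proof.
move=> ii H.
have /choice[f Hf] j := isotropic_growth ii (H j).
pose F := \prod_(j < n) f j.
have gF : linear_growth F.
  apply: big_ind; [exact: linear_growth1|exact: linear_growthM|].
  by move=> j _; case: (Hf j).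
have F0 : F != 0.
  apply: contra_neq (linear_growth_specialization_neq0 0 gF) => ->.
  by rewrite map_poly0.
have [h [r [c [r0 c0 sm Hh]]]] := squarefree_part F0.
exists (HalfCurve F h), r, c; split => // j p pj /=.
have F1 : F.[p.1%:C%C - iota * p.2%:C%C, p.1%:C%C + iota * p.2%:C%C] = 0.
  rewrite /F !horner_prod (bigD1 j) //=.
  by have [_ /(_ p pj) ->] := Hf j; rewrite mul0r.
by split=> // cy; exact: Hh.
Qed.

(** The factors [cw] and [cz] account for the lines on which the squarefree
    parts may lose points of the boundary. *)
Lemma pieces_curve (n : nat) (piece : 'I_n -> regular_arc R) :
  (forall j : 'I_n, ~ complexification (piece j) (isotropic_point1 R) /\
                    ~ complexification (piece j) (isotropic_point2 R)) ->
  exists (Z : curve R) (rw rz cw cz : {poly C}),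
   [/\ [/\ linear_growth (growth_poly (wcurve Z)),
        linear_growth (growth_poly (zcurve Z)),
        generically_smooth (tangent_poly (wcurve Z)) rw &
        generically_smooth (tangent_poly (zcurve Z)) rz],
      rw != 0, rz != 0, cw * cz != 0 &
      forall j p, arc_image (piece j) p ->
      [/\ (growth_poly (wcurve Z)).[wcoord p, zcoord p] = 0,
          (growth_poly (zcurve Z)).[zcoord p, wcoord p] = 0,
          cw.[zcoord p] != 0 -> (tangent_poly (wcurve Z)).[wcoord p, zcoord p] = 0 &
          cz.[wcoord p] != 0 -> (tangent_poly (zcurve Z)).[zcoord p, wcoord p] = 0]].
Proof.
move=> H.
have ii : ('i%C : C) ^+ 2 = -1 by exact: sqr_i.
have nii : (- 'i%C : C) ^+ 2 = -1 by rewrite sqrrN.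
have [h [rw [cw [gw rw0 cw0 sw Hw]]]] := pieces_half_curve ii (fun j => proj1 (H j)).
have [k [rz [cz [gz rz0 cz0 sz Hz]]]] := pieces_half_curve nii (fun j => proj2 (H j)).
exists (Curve h k), rw, rz, cw, cz; split => //.
  by rewrite mulf_neq0.
move=> j p pj.
have [/= w1 w2] := Hw j p pj; have [/= z1 z2] := Hz j p pj.
rewrite -wcoordE -zcoordE in w1 w2.
rewrite !mulNr opprK -wcoordE -zcoordE in z1 z2.
by split.
Qed.
End Boundary.

(** * Derivatives of polynomials along real curves *)
Section Tangency.
Variable R : realType.
Local Notation C := R[i].
Local Notation Re := (@complex.Re R).
Local Notation Im := (@complex.Im R).

Definition is_cderive (phi : R -> C) (t : R) (D : C) : Prop :=
  is_derive t (1 : R) (fun s => Re (phi s)) (Re D) /\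
  is_derive t (1 : R) (fun s => Im (phi s)) (Im D).

Lemma is_cderive_cst (a : C) t : is_cderive (fun=> a) t 0.
Proof. by split; exact: is_derive_cst. Qed.

Lemma cReD (a b : C) : Re (a + b) = Re a + Re b. Proof. by case: a b => ? ? []. Qed.
Lemma cImD (a b : C) : Im (a + b) = Im a + Im b. Proof. by case: a b => ? ? []. Qed.
Lemma cReM (a b : C) : Re (a * b) = Re a * Re b - Im a * Im b.
Proof. by case: a b => ? ? []. Qed.
Lemma cImM (a b : C) : Im (a * b) = Re a * Im b + Im a * Re b.
Proof. by case: a b => ? ? []. Qed.

Lemma is_cderiveD phi psi t a b : is_cderive phi t a -> is_cderive psi t b ->
  is_cderive (fun s => phi s + psi s) t (a + b).
Proof.
move=> [pr pim] [qr qim]; split.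
  rewrite cReD (_ : (fun s => _) = (fun s => Re (phi s)) + (fun s => Re (psi s))).
    exact: is_deriveD.
  by apply/funext => s /=; rewrite cReD.
rewrite cImD (_ : (fun s => _) = (fun s => Im (phi s)) + (fun s => Im (psi s))).
  exact: is_deriveD.
by apply/funext => s /=; rewrite cImD.
Qed.

Lemma is_cderiveM phi psi t a b : is_cderive phi t a -> is_cderive psi t b ->
  is_cderive (fun s => phi s * psi s) t (a * psi t + phi t * b).
Proof.
move=> [pr pim] [qr qim]; split.
  rewrite (_ : (fun s => _) = (fun s => Re (phi s)) * (fun s => Re (psi s)) -
    (fun s => Im (phi s)) * (fun s => Im (psi s))); last first.
    by apply/funext => s /=; rewrite cReM.
  have h := is_deriveB (is_deriveM pr qr) (is_deriveM pim qim).
  apply: (is_derive_eq h).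
  by rewrite cReD !cReM /GRing.scale /=; ring.
rewrite (_ : (fun s => _) = (fun s => Re (phi s)) * (fun s => Im (psi s)) +
  (fun s => Im (phi s)) * (fun s => Re (psi s))); last first.
  by apply/funext => s /=; rewrite cImM.
have h := is_deriveD (is_deriveM pr qim) (is_deriveM pim qr).
apply: (is_derive_eq h).
by rewrite cImD !cImM /GRing.scale /=; ring.
Qed.

Lemma is_cderive_horner (p : {poly C}) phi t a : is_cderive phi t a ->
  is_cderive (fun s => p.[phi s]) t (p^`().[phi t] * a).
Proof.
move=> ph; elim/poly_ind: p => [|p c IH].
  rewrite deriv0 horner0 mul0r (_ : (fun s => _) = fun=> 0).
    exact: is_cderive_cst.
  by apply/funext => s; rewrite horner0.
rewrite derivMXaddC hornerD hornerM hornerX.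
rewrite (_ : (fun s => _) = fun s => p.[phi s] * phi s + c); last first.
  by apply/funext => s; rewrite hornerMXaddC.
have := is_cderiveD (is_cderiveM IH ph) (is_cderive_cst c t).
by congr is_cderive; ring.
Qed.

Lemma map_deriv_MXaddC (p : {poly {poly C}}) (c : {poly C}) :
  map_poly (@deriv C) (p * 'X + c%:P) = map_poly (@deriv C) p * 'X + (c^`())%:P.
Proof.
apply/polyP => i; rewrite !(coefD, coefMX, coefC, coef_map_id0) ?deriv0 //.
by case: i => [|i] /=; rewrite ?add0r ?addr0 // coef_map_id0 ?deriv0.
Qed.

Lemma is_cderive_horner2 (p : {poly {poly C}}) phi psi t a b :
  is_cderive phi t a -> is_cderive psi t b ->
  is_cderive (fun s => p.[phi s, psi s]) t
    (p^`().[phi t, psi t] * a + (map_poly (@deriv C) p).[phi t, psi t] * b).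
Proof.
move=> ph ps; elim/poly_ind: p => [|p c IH].
  rewrite deriv0 map_poly0 !horner0 !mul0r addr0 (_ : (fun s => _) = fun=> 0).
    exact: is_cderive_cst.
  by apply/funext => s; rewrite !horner0.
rewrite derivMXaddC map_deriv_MXaddC !(hornerD, hornerM, hornerX, hornerC).
rewrite (_ : (fun s => _) = fun s => p.[phi s, psi s] * phi s + c.[psi s]); last first.
  by apply/funext => s; rewrite hornerMXaddC hornerD hornerM hornerC.
have := is_cderiveD (is_cderiveM IH ph) (is_cderive_horner c ps).
by congr is_cderive; ring.
Qed.

(** The value at t itself is recovered by continuity, so exceptional points of
    the boundary do no harm at interior points of smooth arcs. *)
Lemma is_derive_vanishing (f : R -> R) (t d : R) : is_derive t (1 : R) f d ->
  (\forall s \near t^', f s = 0) -> f t = 0 /\ d = 0.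
Proof.
move=> fd f0.
have fc : {for t, continuous f}.
  by apply: differentiable_continuous; apply/derivable1_diffP; case: fd.
have ft : f t = 0.
  have h1 : f s @[s --> t^'] --> f t by exact/continuous_withinNx.
  have h2 : f s @[s --> t^'] --> (0 : R).
    have h0 : (cst 0 : R -> R) s @[s --> t^'] --> (0 : R) by exact: cvg_cst.
    apply: cvg_trans h0.
    by apply: near_eq_cvg; apply: filterS f0 => s ->.
  exact: (cvg_unique _ h1 h2).
split=> //.
have f0t : \forall s \near t, f s = (cst 0 : R -> R) s.
  move: f0; rewrite near_withinE; apply: filterS => s /=.
  by have [->|st] := eqVneq s t; [rewrite ft|apply].
have h := near_eq_is_derive f0t fd.
by rewrite -(@derive_val _ _ _ _ _ _ _ h) derive_cst.
Qed.
End Tangency.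

(** * Tangent lines at the vertices of an orbit *)
Section Vertex.
Variable R : realType.
Local Notation C := R[i].
Implicit Types p q u : R * R.

Lemma is_cderive_coord (g : R -> R * R) (t : R) : derivable g t 1 ->
  is_cderive (fun s => zcoord (g s)) t (zcoord (derive1 g t)) /\
  is_cderive (fun s => wcoord (g s)) t (wcoord (derive1 g t)).
Proof.
move=> dg; pose D := derive1 g t.
have gD : h^-1 *: (g (h *: 1 + t) - g t) @[h --> (0 : R)^'] --> D.
  by rewrite /D derive1E; exact: dg.
have g1 : is_derive t (1 : R) (fun s => (g s).1) D.1.
  have h1 : h^-1 *: ((g (h *: 1 + t)).1 - (g t).1) @[h --> (0 : R)^'] --> D.1.
    have c : x.1 @[x --> D] --> D.1 by case: (D) => ? ?; exact: cvg_fst.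
    exact: (cvg_comp _ _ gD c).
  by split; [apply/cvg_ex; exists D.1|exact: cvg_lim h1].
have g2 : is_derive t (1 : R) (fun s => (g s).2) D.2.
  have h2 : h^-1 *: ((g (h *: 1 + t)).2 - (g t).2) @[h --> (0 : R)^'] --> D.2.
    have c : x.2 @[x --> D] --> D.2 by case: (D) => ? ?; exact: cvg_snd.
    exact: (cvg_comp _ _ gD c).
  by split; [apply/cvg_ex; exists D.2|exact: cvg_lim h2].
split; split => //=.
exact: is_deriveN.
Qed.

Lemma near_injective_notin (D : set R) (phi : R -> C) (t : R) (s : seq C) :
  D° t -> {in D &, injective phi} ->
  \forall x \near t^', phi x \notin s.
Proof.
move=> Dt inj; elim: s => [|a s IH]; first by near=> x.
have Da : \forall x \near t^', phi x != a.
  have [[x0 [Dx0 x0a]]|no] := pselect (exists x0, D x0 /\ phi x0 = a).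
    have nx0 : \forall x \near t^', x != x0.
      have [->|x0t] := eqVneq x0 t; first exact: nbhs_dnbhs_neq.
      rewrite near_withinE.
      have : x - x0 @[x --> t] --> t - x0 by apply: cvgB => //; exact: cvg_cst.
      move=> /cvgr_neq0; rewrite subr_eq0 eq_sym => /(_ x0t).
      by apply: filterS => x; rewrite subr_eq0.
    near=> x; have xx0 : x != x0 by near: x.
    apply: contraNneq xx0 => px; apply/eqP; apply: inj; rewrite ?inE ?x0a //.
    by near: x; exact: nbhs_dnbhs.
  near=> x; apply/eqP => px; apply: no; exists x; split => //.
  by near: x; exact: nbhs_dnbhs.
by near=> x; rewrite inE negb_or; apply/andP; split; near: x.
Unshelve. all: by end_near. Qed.

Lemma near_nonroot (D : set R) (phi : R -> C) (t : R) (c : {poly C}) :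
  c != 0 -> D° t -> {in D &, injective phi} ->
  \forall x \near t^', c.[phi x] != 0.
Proof.
move=> c0 Dt inj; have [s cE] := closed_field_poly_normal c.
apply: filterS (near_injective_notin s Dt inj) => x.
apply: contraNneq => cx; rewrite -root_prod_XsubC.
have : root c (phi x) by apply/eqP.
by rewrite {1}cE rootZ ?lead_coef_eq0.
Qed.

(** The polynomial h vanishes along the smooth arc through p, at first except
    for the finitely many parameters where c vanishes, hence at p too; its
    derivative along the arc is then zero.  For phi and psi one takes the two
    isotropic coordinates, in either order. *)
Lemma vertex_tangent (n : nat) (piece : 'I_n -> regular_arc R)
    (B : set (R * R)) (h : {poly {poly C}}) (c : {poly C})
    (phi psi : R * R -> C) p u :
  c != 0 -> injective phi -> injective psi ->
  B = \bigcup_(j in [set: 'I_n]) arc_image (piece j) ->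
  (forall (g : R -> R * R) t, derivable g t 1 ->
     is_cderive (fun s => phi (g s)) t (phi (derive1 g t)) /\
     is_cderive (fun s => psi (g s)) t (psi (derive1 g t))) ->
  (forall a v, phi (a *: v) = a%:C%C * phi v /\ psi (a *: v) = a%:C%C * psi v) ->
  (forall q, B q -> c.[psi q] != 0 -> h.[phi q, psi q] = 0) ->
  unit_tangent B p u ->
  h.[phi p, psi p] = 0 /\
  h^`().[phi p, psi p] * phi u + (map_poly (@deriv C) h).[phi p, psi p] * psi u = 0.
Proof.
move=> c0 phi_inj psi_inj BE der scal van [_ [g [t [k [_ Dt gt Bg gk]]]]].
have dgt : derivable g t 1 by exact: arc_derivable.
have [dphi dpsi] := der g t dgt.
have gc : {for t, continuous g}.
  by apply: differentiable_continuous; apply/derivable1_diffP.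
have sub x : [set` arc_dom g] x -> x \in arc_dom g by [].
have near0 : \forall s \near t^', h.[phi (g s), psi (g s)] = 0.
  have nB : \forall s \near t^', B (g s).
    have h1 : \forall s \near t, B (g s) <-> arc_image g (g s).
      by apply: (gc (fun q => B q <-> arc_image g q)); rewrite gt; exact: Bg.
    apply: nbhs_dnbhs; near=> s.
    have hs : B (g s) <-> arc_image g (g s) by near: s.
    by apply/hs; exists s => //; near: s; exact: Dt.
  have nc : \forall s \near t^', c.[psi (g s)] != 0.
    apply: (near_nonroot (phi := fun s => psi (g s)) c0 Dt) => x y xD yD.
    by move=> /psi_inj /(arc_injective _ _); apply; rewrite ?inE in xD yD.
  near=> s; apply: van; first by near: s.
  by near: s.
have hd := is_cderive_horner2 h dphi dpsi.
have [re0 dre0] := is_derive_vanishing hd.1 (filterS (fun s e => congr1 _ e) near0).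
have [im0 dim0] := is_derive_vanishing hd.2 (filterS (fun s e => congr1 _ e) near0).
rewrite gt in re0 im0 dre0 dim0.
have complex0 (z : C) : complex.Re z = 0 -> complex.Im z = 0 -> z = 0.
  by case: z => a b /= -> ->.
split; first exact: complex0.
have := complex0 _ dre0 dim0.
rewrite gk (scal k u).1 (scal k u).2 => /eqP.
(* The velocity is k times u, and k is not zero as the arc is regular. *)
rewrite mulrCA [X in _ + X]mulrCA -mulrDr mulf_eq0 => /orP[|/eqP //].
move=> /eqP /complexI k0; have := arc_regular Dt.
by rewrite gk k0 scale0r eqxx.
Unshelve. all: by end_near. Qed.
End Vertex.

(** * Billiard orbits are complex orbits *)
Section BilliardStep.
Variable R : realType.
Local Notation C := R[i].
Implicit Types u v p : R * R.

Lemma zcoordZ (a : R) v : zcoord (a *: v) = a%:C%C * zcoord v.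
Proof.
by apply/eqP; rewrite eq_complex /= !(mul0r, subr0, addr0) !eqxx.
Qed.

Lemma wcoordZ (a : R) v : wcoord (a *: v) = a%:C%C * wcoord v.
Proof.
by apply/eqP; rewrite eq_complex /= !(mul0r, subr0, addr0) mulrN !eqxx.
Qed.

Lemma zcoordD u v : zcoord (u + v) = zcoord u + zcoord v.
Proof. by []. Qed.

Lemma wcoordD u v : wcoord (u + v) = wcoord u + wcoord v.
Proof. by apply/eqP; rewrite eq_complex /= opprD !eqxx. Qed.

Lemma unit_coords u : unit_vector u -> zcoord u * wcoord u = 1.
Proof.
rewrite /unit_vector /dotp => uu.
by apply/eqP; rewrite eq_complex /=; apply/andP; split; apply/eqP; lra.
Qed.

Lemma zcoord_reflect u v : unit_vector u ->
  zcoord (reflect_dir u v) = zcoord u ^+ 2 * wcoord v.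
Proof.
rewrite /unit_vector /reflect_dir /dotp => uu.
have u1 := congr1 (fun x => x * v.1) uu; have u2 := congr1 (fun x => x * v.2) uu.
by apply/eqP; rewrite eq_complex expr2 /=; apply/andP; split; apply/eqP;
  rewrite /GRing.scale /=; lra.
Qed.

Lemma wcoord_reflect u v : unit_vector u ->
  wcoord (reflect_dir u v) = wcoord u ^+ 2 * zcoord v.
Proof.
rewrite /unit_vector /reflect_dir /dotp => uu.
have u1 := congr1 (fun x => x * v.1) uu; have u2 := congr1 (fun x => x * v.2) uu.
by apply/eqP; rewrite eq_complex expr2 /=; apply/andP; split; apply/eqP;
  rewrite /GRing.scale /=; lra.
Qed.

Definition complex_state (x : (R * R) * (R * R)) : state R :=
  State (zcoord x.1) (wcoord x.1) (zcoord x.2) (wcoord x.2).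

Variables (n : nat) (piece : 'I_n -> regular_arc R) (Omega : set (R * R)).
Variables (Z : curve R) (cw cz : {poly C}).
Hypothesis boundaryE :
  boundary Omega = \bigcup_(j in [set: 'I_n]) arc_image (piece j).
Hypothesis c0 : cw * cz != 0.
Hypothesis HZ : forall j p, arc_image (piece j) p ->
  [/\ (growth_poly (wcurve Z)).[wcoord p, zcoord p] = 0,
      (growth_poly (zcurve Z)).[zcoord p, wcoord p] = 0,
      cw.[zcoord p] != 0 -> (tangent_poly (wcurve Z)).[wcoord p, zcoord p] = 0 &
      cz.[wcoord p] != 0 -> (tangent_poly (zcurve Z)).[zcoord p, wcoord p] = 0].

Lemma complex_step_of_billiard_step x y :
  billiard_step Omega x y ->
  complex_step Z (complex_state x) (complex_state y).
Proof.
move=> [t [t0 _ y1 By [u tu y2]]].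
have uu : unit_vector u by case: tu.
have [cw0 cz0] : cw != 0 /\ cz != 0.
  by move: c0; rewrite mulf_eq0 negb_or => /andP.
have [w0 wt] : (tangent_poly (wcurve Z)).[wcoord y.1, zcoord y.1] = 0 /\
    tangent_half (wcurve Z) (wcoord y.1) (zcoord y.1) (wcoord u) (zcoord u).
  apply: (vertex_tangent cw0 (@wcoord_inj R) (@zcoord_inj R) boundaryE _ _ _ tu).
  - by move=> g s dg; have [] := is_cderive_coord dg.
  - by move=> a v; rewrite wcoordZ zcoordZ.
  - by move=> q; rewrite boundaryE => -[j _ /HZ[_ _ + _]].
have [z0 zt] : (tangent_poly (zcurve Z)).[zcoord y.1, wcoord y.1] = 0 /\
    tangent_half (zcurve Z) (zcoord y.1) (wcoord y.1) (zcoord u) (wcoord u).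
  apply: (vertex_tangent cz0 (@zcoord_inj R) (@wcoord_inj R) boundaryE _ _ _ tu).
  - by move=> g s dg; have [] := is_cderive_coord dg.
  - by move=> a v; rewrite wcoordZ zcoordZ.
  - by move=> q; rewrite boundaryE => -[j _ /HZ[_ _ _ +]].
have [fw fz] : (growth_poly (wcurve Z)).[wcoord y.1, zcoord y.1] = 0 /\
    (growth_poly (zcurve Z)).[zcoord y.1, wcoord y.1] = 0.
  by move: By; rewrite boundaryE => -[j _ /HZ[]].
exists (zcoord u), (wcoord u); split => //=.
- exact: unit_coords.
- rewrite y1 zcoordD wcoordD zcoordZ wcoordZ.
  by rewrite !(addrC (_ x.1)) !addrK mulrCA [RHS]mulrCA [wcoord _ * _]mulrC.
- by rewrite y2 zcoord_reflect // wcoord_reflect.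
Qed.

Lemma complex_cycle_of_periodic_orbit k x : periodic_orbit Omega k x ->
  complex_path Z k (complex_state (x 0%N)) (complex_state (x 0%N)).
Proof.
move=> [_ steps xk].
suff H m : (m <= k)%N ->
    complex_path Z m (complex_state (x (k - m)%N)) (complex_state (x 0%N)).
  by have := H k (leqnn k); rewrite subnn.
elim: m => [_|m IH mk]; first by rewrite subn0 xk.
exists (complex_state (x (k - m)%N)); last exact/IH/ltnW.
apply: complex_step_of_billiard_step.
have -> : (k - m = (k - m.+1).+1)%N by rewrite subnSK.
by apply: steps; rewrite ltn_subrL (leq_trans _ mk).
Qed.
End BilliardStep.

(** * Measurability and null sets in the phase space *)
Section Measurability.
Variable R : realType.
Local Notation C := R[i].
Local Notation Re := (@complex.Re R).
Local Notation Im := (@complex.Im R).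

Section MeasurableFormula.
Context d (T : measurableType d).
Implicit Types phi psi : T -> C.

Definition measurable_complex phi : Prop :=
  measurable_fun setT (fun x => Re (phi x)) /\
  measurable_fun setT (fun x => Im (phi x)).

Lemma measurable_complex_cst (a : C) : measurable_complex (fun=> a).
Proof. by split; exact: measurable_cst. Qed.

Lemma measurable_complexD phi psi :
  measurable_complex phi -> measurable_complex psi ->
  measurable_complex (fun x => phi x + psi x).
Proof.
move=> [pr pim] [qr qim]; split.
  rewrite (_ : (fun x => _) = (fun x => Re (phi x)) \+ (fun x => Re (psi x))).
    exact: measurable_funD.
  by apply/funext => x /=; rewrite cReD.
rewrite (_ : (fun x => _) = (fun x => Im (phi x)) \+ (fun x => Im (psi x))).
  exact: measurable_funD.
by apply/funext => x /=; rewrite cImD.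
Qed.

Lemma measurable_complexM phi psi :
  measurable_complex phi -> measurable_complex psi ->
  measurable_complex (fun x => phi x * psi x).
Proof.
move=> [pr pim] [qr qim]; split.
  rewrite (_ : (fun x => _) = ((fun x => Re (phi x)) \* (fun x => Re (psi x))) \-
    ((fun x => Im (phi x)) \* (fun x => Im (psi x)))).
    by apply: measurable_funB; exact: measurable_funM.
  by apply/funext => x /=; rewrite cReM.
rewrite (_ : (fun x => _) = ((fun x => Re (phi x)) \* (fun x => Im (psi x))) \+
  ((fun x => Im (phi x)) \* (fun x => Re (psi x)))).
  by apply: measurable_funD; exact: measurable_funM.
by apply/funext => x /=; rewrite cImM.
Qed.

Variable e : T -> seq C.
Hypothesis me : forall i, measurable_complex (fun x => (e x)`_i).

Lemma measurable_eval (t : GRing.term C) : GRing.rterm t ->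
  measurable_complex (fun x => GRing.eval (e x) t).
Proof.
elim: t => //=.
- by move=> a IHa b IHb /andP[/IHa ? /IHb ?]; exact: measurable_complexD.
- move=> a IHa /IHa ma.
  rewrite (_ : (fun x => _) = fun x => (-1) * GRing.eval (e x) a).
    exact: measurable_complexM (measurable_complex_cst _) ma.
  by apply/funext => x; rewrite mulN1r.
- move=> a IHa n /IHa ma.
  rewrite (_ : (fun x => _) = fun x => n%:R * GRing.eval (e x) a).
    exact: measurable_complexM (measurable_complex_cst _) ma.
  by apply/funext => x; rewrite mulr_natl.
- by move=> a IHa b IHb /andP[/IHa ? /IHb ?]; exact: measurable_complexM.
- move=> a IHa n /IHa ma; elim: n => [|n IH].
    by rewrite (_ : (fun x => _) = fun=> 1) //; exact: measurable_complex_cst.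
  rewrite (_ : (fun x => _) =
    fun x => GRing.eval (e x) a * GRing.eval (e x) a ^+ n).
    exact: measurable_complexM.
  by apply/funext => x; rewrite exprS.
Qed.

Lemma measurable_qf_eval (f : GRing.formula C) :
  GRing.qf_form f -> GRing.rformula f ->
  measurable [set x | GRing.qf_eval (e x) f].
Proof.
elim: f => //=.
- case=> _ _.
    by rewrite (_ : [set x | _] = setT) //; apply/seteqP; split.
  by rewrite (_ : [set x | _] = set0) //; apply/seteqP; split.
- move=> a b _ /andP[/measurable_eval[ar ai] /measurable_eval[br bi]].
  rewrite (_ : [set x | _] =
    ((fun x => Re (GRing.eval (e x) a)) \- (fun x => Re (GRing.eval (e x) b)))
      @^-1` [set 0] `&`
    ((fun x => Im (GRing.eval (e x) a)) \- (fun x => Im (GRing.eval (e x) b)))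
      @^-1` [set 0]).
    apply: measurableI; rewrite -[X in measurable X]setTI;
    by apply: measurable_funB => //; exact: measurable_set1.
  apply/seteqP; split=> x /=.
    by move=> /eqP ->; rewrite !subrr.
  move=> [/eqP + /eqP]; rewrite !subr_eq0 => re im.
  by rewrite eq_complex re im.
- move=> f IHf g IHg /andP[qf qg] /andP[rf rg].
  rewrite (_ : [set x | _] = [set x | GRing.qf_eval (e x) f] `&`
                             [set x | GRing.qf_eval (e x) g]).
    by apply: measurableI; [exact: IHf|exact: IHg].
  by apply/seteqP; split=> x /= => [/andP|[-> ->]].
- move=> f IHf g IHg /andP[qf qg] /andP[rf rg].
  rewrite (_ : [set x | _] = [set x | GRing.qf_eval (e x) f] `|`
                             [set x | GRing.qf_eval (e x) g]).
    by apply: measurableU; [exact: IHf|exact: IHg].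
  by apply/seteqP; split=> x /= => [/orP|[->|->]]; rewrite ?orbT.
- move=> f IHf g IHg /andP[qf qg] /andP[rf rg].
  rewrite (_ : [set x | _] = ~` [set x | GRing.qf_eval (e x) f] `|`
                             [set x | GRing.qf_eval (e x) g]).
    by apply: measurableU; [apply: measurableC; exact: IHf|exact: IHg].
  apply/seteqP; split=> x /=; rewrite implybE.
    by move=> /orP[/negP|]; [left|right].
  by move=> [/negP|] ->; rewrite ?orbT.
- move=> f IHf qf rf.
  rewrite (_ : [set x | _] = ~` [set x | GRing.qf_eval (e x) f]).
    by apply: measurableC; exact: IHf.
  by apply/seteqP; split=> x /= /negP.
Qed.
End MeasurableFormula.

Lemma product_measure_null_of_sections (A : set (R * R)) (N : set R) :
  measurable A -> countable N ->
  (forall t, ~ N t -> countable (xsection A t)) ->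
  ((@lebesgue_measure R) \x (@lebesgue_measure R))%E A = 0%E.
Proof.
move=> mA cN HA.
rewrite /product_measure1 /=.
rewrite (ae_eq_integral (cst 0%E)) //.
- by rewrite integral0.
- exact: measurable_fun_xsection.
exists N; split.
- exact: countable_measurable.
- exact: countable_lebesgue_measure0.
move=> t /=; apply: contra_notP => /HA cA _.
exact: countable_lebesgue_measure0.
Qed.

Lemma direction_injective :
  {in [set t : R | 0 <= t < 2 * pi] &, injective (@direction R)}.
Proof.
move=> a b; rewrite !inE /= => a2 b2 [cab sab].
wlog ab : a b a2 b2 cab sab / a <= b.
  by move=> W; have [/W|/ltW/W] := leP a b; [apply|move=> ->].
apply/eqP; rewrite eq_le ab /= leNgt; apply/negP => {}ab.
have c1 : cos (b - a) = 1.
  by rewrite cosB cab sab -!expr2 cos2Dsin2.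
(* Now 0 < b - a < 2 pi and cos (b - a) = 1, against the half-angle formula. *)
have : 0 < sin ((b - a) / 2) by apply: sin_gt0_pi; apply/andP; split; lra.
have : cos ((b - a) / 2 *+ 2) = 1 by rewrite -mulr_natr divfK.
rewrite cos_mulr2n => h s0.
have := cos2Dsin2 ((b - a) / 2); have := exprn_gt0 2 s0; lra.
Qed.
End Measurability.

Section ArcChart.
Variable R : realType.
Local Notation C := R[i].
Variable g : regular_arc R.
Let D := [set` arc_dom g]°.

Let openD : open D. Proof. exact: open_interior. Qed.

Lemma arc_continuous_interior t : D t -> {for t, continuous g}.
Proof.
move=> Dt; apply: differentiable_continuous; apply/derivable1_diffP.
exact: arc_derivable.
Qed.

Lemma measurable_arc_coordinates :
  measurable_fun setT ((fun t => (g t).1) \_ D) /\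
  measurable_fun setT ((fun t => (g t).2) \_ D).
Proof.
have mD : measurable D by exact: open_measurable.
split.
  apply/(measurable_restrictT _ mD).
  apply: open_continuous_measurable_fun => // t /set_mem /arc_continuous_interior gt.
  have c : x.1 @[x --> g t] --> (g t).1 by case: (g t) => ? ?; exact: cvg_fst.
  exact: (cvg_comp _ _ gt c).
apply/(measurable_restrictT _ mD).
apply: open_continuous_measurable_fun => // t /set_mem /arc_continuous_interior gt.
have c : x.2 @[x --> g t] --> (g t).2 by case: (g t) => ? ?; exact: cvg_snd.
exact: (cvg_comp _ _ gt c).
Qed.

Lemma countable_injective_seq (phi : R -> C) (X : set R) (s : seq C) :
  {in X &, injective phi} -> (forall t, X t -> phi t \in s) -> countable X.
Proof.
move=> inj Xs; apply/countable_injP; exists (fun t => index (phi t) s).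
move=> a b aX bX eab; apply: inj => //.
rewrite -(nth_index 0 (Xs a (set_mem aX))) eab nth_index //.
exact: Xs (set_mem bX).
Qed.

(** Outside the interior of its domain the arc need not be measurable; there
    its coordinates are replaced by 0. *)
Lemma arc_chart_measurable (f : GRing.formula C) :
  GRing.qf_form f -> GRing.rformula f ->
  measurable [set x : R * R | [/\ D x.1, 0 <= x.2 < 2 * pi &
    GRing.qf_eval [:: zcoord (g x.1); wcoord (g x.1); zcoord (direction x.2)] f]].
Proof.
move=> qf rf; have [m1 m2] := measurable_arc_coordinates.
pose G t : R * R := (((fun t => (g t).1) \_ D) t, ((fun t => (g t).2) \_ D) t).
have GE t : D t -> G t = g t.
  by move=> Dt; rewrite /G /patch mem_set //; case: (g t).
pose e (x : R * R) := [:: zcoord (G x.1); wcoord (G x.1); zcoord (direction x.2)].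
have me i : measurable_complex (fun x => (e x)`_i).
  have mc : measurable_fun setT (fun x : R * R => cos x.2).
    apply: (measurableT_comp (f := cos)); last exact: measurable_snd.
    exact: continuous_measurable_fun (@continuous_cos R).
  have ms : measurable_fun setT (fun x : R * R => sin x.2).
    apply: (measurableT_comp (f := sin)); last exact: measurable_snd.
    exact: continuous_measurable_fun (@continuous_sin R).
  have n1 := measurableT_comp m1 (@measurable_fst _ _ R R).
  have n2 := measurableT_comp m2 (@measurable_fst _ _ R R).
  case: i => [|[|[|i]]].
  - by split; [exact: n1|exact: n2].
  - split; first exact: n1.
    by apply: (measurableT_comp _ n2); exact: oppr_measurable.
  - by split; [exact: mc|exact: ms].
  - rewrite (_ : (fun x => _) = fun=> 0); first exact: measurable_complex_cst.
    by apply/funext => x; rewrite /= nth_nil.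
rewrite (_ : [set x | _] =
  (D `*` [set` `[0, 2 * pi[]) `&` [set x | GRing.qf_eval (e x) f]).
  apply: measurableI; last exact: measurable_qf_eval.
  by apply: measurableX; [exact: open_measurable|exact: measurable_itv].
apply/seteqP; split=> -[t theta] /=; rewrite in_itv /= /e /=.
  by move=> [Dt th ev]; rewrite GE.
by move=> [[Dt th]]; rewrite GE // => ev; split.
Qed.

Lemma arc_chart_null (f : GRing.formula C) (s : seq C) :
  GRing.qf_form f -> GRing.rformula f ->
  (forall z w, z \notin s -> exists2 p : {poly C}, p != 0 &
    forall l, GRing.qf_eval [:: z; w; l] f -> root p l) ->
  ((@lebesgue_measure R) \x (@lebesgue_measure R))%E.-negligible
    [set x : R * R | [/\ D x.1, 0 <= x.2 < 2 * pi &
    GRing.qf_eval [:: zcoord (g x.1); wcoord (g x.1); zcoord (direction x.2)] f]].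
Proof.
move=> qf rf Hs; set A := [set x | _].
have mA : measurable A by exact: arc_chart_measurable.
exists A; split => //.
apply: (@product_measure_null_of_sections _ _ [set t | D t /\ zcoord (g t) \in s]) => //.
  apply: (@countable_injective_seq (fun t => zcoord (g t)) _ s) => [a b|t []//].
  move=> /set_mem[Da _] /set_mem[Db _] /zcoord_inj.
  by apply: arc_injective; [exact: (interior_subset Da)|exact: (interior_subset Db)].
move=> t Nt; have [Dt|nDt] := pselect (D t); last first.
  rewrite (_ : xsection A t = set0) //.
  by apply/seteqP; split=> [x /set_mem[]|x []].
have [|p p0 Hp] := Hs (zcoord (g t)) (wcoord (g t)).
  by apply/negP => ts; apply: Nt.
have [r pE] := closed_field_poly_normal p.
apply: (@countable_injective_seq (fun th => zcoord (direction th)) _ r).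
  move=> a b /set_mem/set_mem[_ a2 _] /set_mem/set_mem[_ b2 _] /zcoord_inj.
  by apply: direction_injective; rewrite inE.
move=> th /set_mem[_ _ /Hp].
by rewrite {1}pE rootZ ?lead_coef_eq0 // root_prod_XsubC.
Qed.
End ArcChart.

(** * Odd periodic orbits *)
Theorem corollary1p10 (R : realType) (Omega : set (R * R)) (n : nat)
    (piece : 'I_n -> regular_arc R) :
  domain Omega ->
  piecewise_algebraic_boundary Omega piece ->
  (forall j : 'I_n, ~ complexification (piece j) (isotropic_point1 R) /\
                    ~ complexification (piece j) (isotropic_point2 R)) ->
  phase_measure_zero piece (odd_periodic Omega).
Proof.
move=> _ [_ BE] isotropic_free j.
have [Z [rw [rz [cw [cz [[gw gz sw sz] rw0 rz0 c0 HZ]]]]]] :=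
  pieces_curve isotropic_free.
have /choice[f Hf] k : exists f : GRing.formula R[i],
    GRing.qf_form f && GRing.rformula f /\ forall z w l,
      GRing.qf_eval [:: z; w; l] f <-> exists2 l', l * l' = 1 &
        complex_path Z k (State z w l l') (State z w l l').
  by have [f fok Hf] := cycle_quantifier_elim Z k; exists f.
pose A k := [set x : R * R | [/\ [set` arc_dom (piece j)]° x.1,
  0 <= x.2 < 2 * pi & GRing.qf_eval [:: zcoord (piece j x.1);
    wcoord (piece j x.1); zcoord (direction x.2)] (f k)]].
pose U := \bigcup_k (if odd k then A k else set0).
suff : ((@lebesgue_measure R) \x (@lebesgue_measure R))%E.-negligible U.
  apply: negligibleS => -[t theta] /= [Dt th [k [x [odd_k orbit x0]]]].
  exists k => //; rewrite odd_k; split => //=.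
  have [_ Hk] := Hf k; apply/Hk.
  exists (wcoord (direction theta)).
    by apply: unit_coords; rewrite /unit_vector /dotp -!expr2 cos2Dsin2.
  have := complex_cycle_of_periodic_orbit BE c0 HZ orbit.
  by rewrite x0.
apply: negligible_bigcup => k; case: ifPn => [odd_k|_]; last exact: negligible_set0.
have [fok Hk] := Hf k; have /andP[qf rf] := fok.
have [s Hs] := generic_start_cofinite k gw gz rw0 rz0.
apply: (@arc_chart_null _ _ _ s) => // z w /Hs gen.
by apply: (cycle_direction_root gw gz sw sz odd_k gen fok) => l /Hk.
Qed.
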